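(* Let $A,A_0:\mathbb{R}\to M_n(\mathbb{R})$ and $f:\mathbb{R}\times\mathbb{R}^n\times\mathbb{R}^n\to\mathbb{R}^n$ be continuous, and let $M,M_0,\mu,\ell_1,\ell_2>0$ be constants such that, for all $t\in\mathbb{R}$ and $x,x',y,y'\in\mathbb{R}^n$, $\|A(t)\|\le M$, $\|A_0(t)\|\le M_0$, $|f(t,x,y)|\le\mu$ and $|f(t,x,y)-f(t,x',y')|\le \ell_1|x-x'|+\ell_2|y-y'|$. Let $\gamma$ be the piecewise constant argument associated with sequences $\{t_i\}$, $\{\zeta_i\}$ and constant $\theta>0$ as in the context, and assume there are $\nu^+,\nu^->0$ with $$\sup_{k\in\mathbb{Z}}\rho_k^+(A)\ln\rho_k^+(A_0)\le\nu^+<1,\qquad \sup_{k\in\mathbb{Z}}\rho_k^-(A)\ln\rho_k^-(A_0)\le\nu^-<1 .$$ Suppose that the linear system $\dot y(t)=A(t)y(t)+A_0(t)y(\gamma(t))$ has an $\alpha$-exponential dichotomy on $(-\infty,\infty)$ with projection $P$ and constants $K\ge1$, $\alpha>0$, and that for every integer $k$ the series $$\sum_{r=-\infty}^{k}PZ(0,t_r)\int_{t_r}^{\zeta_r}\Phi(t_r,s)\,ds,\qquad \sum_{r=-\infty}^{k}PZ(0,t_{r+1})\int_{\zeta_r}^{t_{r+1}}\Phi(t_{r+1},s)\,ds,$$ $$\sum_{r=k}^{+\infty}(I-P)Z(0,t_r)\int_{t_r}^{\zeta_r}\Phi(t_r,s)\,ds,\qquad \sum_{r=k}^{+\infty}(I-P)Z(0,t_{r+1})\int_{\zeta_r}^{t_{r+1}}\Phi(t_{r+1},s)\,ds$$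 are absolutely convergent. Assume moreover $$2(\ell_1+\ell_2)K\rho^*<\alpha,$$ $$F_1(\theta)(M_0+\ell_2)\theta=v<1,\quad F_1(\theta)=\frac{e^{(M+\ell_1)\theta}-1}{(M+\ell_1)\theta},$$ $$F_0(\theta)M_0\theta=\tilde v<1,\quad F_0(\theta)=\frac{e^{M\theta}-1}{M\theta},$$ $$\alpha<M+\min\Big\{\ell_1+\frac{M_0+\ell_2}{1-v}e^{(M+\ell_1)\theta},\ \frac{M_0}{1-\tilde v}e^{M\theta}\Big\}.$$ Then the systems $\dot y(t)=A(t)y(t)+A_0(t)y(\gamma(t))$ and $\dot x(t)=A(t)x(t)+A_0(t)x(\gamma(t))+f(t,x(t),x(\gamma(t)))$ are Hölder strongly topologically equivalent; namely, they are strongly topologically equivalent and there exist constants $C_1>1$, $D_1>1$, $C_2\in(0,1)$, $D_2\in(0,1)$ such that the maps $H$ and $L$ satisfy, for all $t\in\mathbb{R}$, $$|H(t,\xi)-H(t,\xi')|\le C_1|\xi-\xi'|^{C_2}\quad\text{and}\quad |L(t,\nu)-L(t,\nu')|\le D_1|\nu-\nu'|^{D_2}$$ for all $\xi,\xi',\nu,\nu'\in\mathbb{R}^n$ with $|\xi-\xi'|<1$ and $|\nu-\nu'|<1$.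
   Context: $|\cdot|$ is a norm on $\mathbb{R}^n$ and $\|\cdot\|$ the induced matrix norm. Argument $\gamma$: $\{t_i\}_{i\in\mathbb{Z}}$, $\{\zeta_i\}_{i\in\mathbb{Z}}$ are real sequences with $t_i<t_{i+1}$ and $t_i\le\zeta_i\le t_{i+1}$ for all $i$, $t_i\to\pm\infty$ as $i\to\pm\infty$, $t_{i+1}-t_i\le\theta$ for all $i$, and $\gamma(t)=\zeta_i$ for $t\in[t_i,t_{i+1})$. Solutions: a continuous function $u$ is a solution of such a differential equation if $u'(t)$ exists for every $t\in\mathbb{R}$, except possibly at the points $t_i$, where one-sided derivatives exist, the equation holds on each $(t_i,t_{i+1})$, and it holds for the right derivative at each $t_i$. Notation: $\Phi(t)$ is the fundamental matrix of $x'=A(t)x$ with $\Phi(0)=I$, $\Phi(t,s)=\Phi(t)\Phi^{-1}(s)$. For a matrix function $Q$, $\rho_k^+(Q)=\exp\big(\int_{t_k}^{\zeta_k}\|Q(s)\|ds\big)$, $\rho_k^-(Q)=\exp\big(\int_{\zeta_k}^{t_{k+1}}\|Q(s)\|ds\big)$; $\rho(A)=\sup_{k}\rho_k^+(A)\rho_k^-(A)$ (finite) and $\rho^*=\rho(A)e^{\alpha\theta}$. $Z(t,\tau)$ is the transition matrix of the linear system: $t\mapsto Z(t,\tau)\xi$ is its unique solution on $\mathbb{R}$ with value $\xi$ at $t=\tau$ (well defined and invertible under the condition on $\rho_k^\pm$). $\alpha$-exponential dichotomy: there is a projection $P$ ($P^2=P$) and constants $K\ge1$, $\alpha>0$ with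 $\|Z_p(t,s)\|\le Ke^{-\alpha|t-s|}$ for all $t,s$, where $Z_p(t,s)=Z(t,0)PZ(0,s)$ if $t\ge s$ and $Z_p(t,s)=-Z(t,0)(I-P)Z(0,s)$ if $s>t$. Topological equivalence (of the linear and the nonlinear system): there exists $H:\mathbb{R}\times\mathbb{R}^n\to\mathbb{R}^n$ such that (i) for each fixed $t$, $u\mapsto H(t,u)$ is a homeomorphism of $\mathbb{R}^n$; (ii) $H(t,u)-u$ is bounded on $\mathbb{R}\times\mathbb{R}^n$; (iii) if $x(t)$ is a solution of the nonlinear system then $H(t,x(t))$ is a solution of the linear system; and the function $L(t,u)=H^{-1}(t,u)$ (inverse of $H(t,\cdot)$ at $u$) also has properties (i)–(iii), with the roles of the two systems in (iii) exchanged. Strong topological equivalence: in addition $H$ and $L$ are uniformly continuous for all $t$, i.e. for all $t$ the maps $u\mapsto H(t,u)$ and $u\mapsto L(t,u)$ are uniformly continuous. *)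

(* Defs.v *)
From HB Require Import structures.
From mathcomp Require Import all_boot all_order all_algebra.
From mathcomp Require Import all_classical all_reals all_analysis.

Set Implicit Arguments.
Unset Strict Implicit.
Unset Printing Implicit Defensive.

Import Order.TTheory GRing.Theory Num.Theory.
Import numFieldNormedType.Exports.

Local Open Scope classical_set_scope.
Local Open Scope ring_scope.

(* The canonical norm of 'cV[R]_n is the max norm, whereas |.| is an arbitrary
   norm N. Quantitative conditions use N; purely topological ones (continuity,
   derivatives, limits, uniform continuity) use the canonical structure of
   'cV[R]_n, which induces the same topology and uniformity as N. *)
Record is_norm (R : realType) (n : nat) (N : 'cV[R]_n -> R) : Prop := IsNorm {
  norm_triangle : forall x y, N (x + y) <= N x + N y ;
  norm_homogeneous : forall (a : R) x, N (a *: x) = `|a| * N x ;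
  norm_definite : forall x, N x = 0 -> x = 0
}.

(* The set is nonempty and bounded as soon as N is a norm. *)
Definition opnorm (R : realType) (n : nat) (N : 'cV[R]_n -> R) (B : 'M[R]_n) : R :=
  sup [set N (B *m x) | x in [set x | N x <= 1]].

Definition integral_mx (R : realType) (m p : nat) (a b : R)
    (F : R -> 'M[R]_(m, p)) : 'M[R]_(m, p) :=
  \matrix_(i, j) \int[@lebesgue_measure R]_(s in `[a, b]) F s i j.

(* gamma is the piecewise constant argument of the sequences t and zeta. *)
Record is_pca (R : realType) (t zeta : int -> R) (theta : R) (gamma : R -> R)
    : Prop := IsPca {
  pca_lt : forall i, t i < t (i + 1) ;
  pca_zeta : forall i, t i <= zeta i <= t (i + 1) ;
  pca_pinfty : t k%:Z @[k --> \oo] --> +oo ;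
  pca_ninfty : t (- k%:Z) @[k --> \oo] --> -oo ;
  pca_gap : forall i, t (i + 1) - t i <= theta ;
  pca_gamma : forall i s, t i <= s < t (i + 1) -> gamma s = zeta i
}.

(* The solutions of u'(s) = F s (u s) (u (gamma s)). By pca_pinfty and pca_ninfty
   every s that is none of the t i lies in some ]t i, t (i + 1)[. *)
Record is_solution (R : realType) (n : nat) (t : int -> R) (gamma : R -> R)
    (F : R -> 'cV[R]_n -> 'cV[R]_n -> 'cV[R]_n) (u : R -> 'cV[R]_n)
    : Prop := IsSolution {
  sol_continuous : continuous u ;
  sol_derive : forall i s, t i < s < t (i + 1) ->
    is_derive s (1 : R) u (F s (u s) (u (gamma s))) ;
  sol_left : forall i,
    cvg (h^-1 *: (u (t i + h) - u (t i)) @[h --> (0 : R)^'-]) ;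
  sol_right : forall i,
    h^-1 *: (u (t i + h) - u (t i)) @[h --> (0 : R)^'+]
      --> F (t i) (u (t i)) (u (gamma (t i)))
}.

Definition lin_rhs (R : realType) (n : nat) (A A0 : R -> 'M[R]_n)
    (s : R) (y z : 'cV[R]_n) : 'cV[R]_n :=
  A s *m y + A0 s *m z.

Definition nonlin_rhs (R : realType) (n : nat) (A A0 : R -> 'M[R]_n)
    (f : R -> 'cV[R]_n -> 'cV[R]_n -> 'cV[R]_n)
    (s : R) (x z : 'cV[R]_n) : 'cV[R]_n :=
  A s *m x + A0 s *m z + f s x z.

Definition is_fundamental (R : realType) (n : nat) (A Phi : R -> 'M[R]_n) : Prop :=
  Phi 0 = 1%:M /\ forall s, is_derive s (1 : R) Phi (A s *m Phi s).

Definition Phi2 (R : realType) (n : nat) (Phi : R -> 'M[R]_n) (s r : R) : 'M[R]_n :=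
  Phi s *m invmx (Phi r).

Definition is_transition (R : realType) (n : nat) (t : int -> R) (gamma : R -> R)
    (A A0 : R -> 'M[R]_n) (Z : R -> R -> 'M[R]_n) : Prop :=
  forall (tau : R) (xi : 'cV[R]_n),
    unique (fun y => is_solution t gamma (lin_rhs A A0) y /\ y tau = xi)
           (fun s => Z s tau *m xi).

Definition rho_plus (R : realType) (n : nat) (N : 'cV[R]_n -> R)
    (t zeta : int -> R) (Q : R -> 'M[R]_n) (k : int) : R :=
  expR (\int[@lebesgue_measure R]_(s in `[t k, zeta k]) opnorm N (Q s)).

Definition rho_minus (R : realType) (n : nat) (N : 'cV[R]_n -> R)
    (t zeta : int -> R) (Q : R -> 'M[R]_n) (k : int) : R :=
  expR (\int[@lebesgue_measure R]_(s in `[zeta k, t (k + 1)]) opnorm N (Q s)).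

(* The range is bounded when the operator norms of Q s and the gaps of t are. *)
Definition rho (R : realType) (n : nat) (N : 'cV[R]_n -> R)
    (t zeta : int -> R) (Q : R -> 'M[R]_n) : R :=
  sup (range (fun k => rho_plus N t zeta Q k * rho_minus N t zeta Q k)).

Definition rho_star (R : realType) (n : nat) (N : 'cV[R]_n -> R)
    (t zeta : int -> R) (theta alpha : R) (Q : R -> 'M[R]_n) : R :=
  rho N t zeta Q * expR (alpha * theta).

Definition Zp (R : realType) (n : nat) (Z : R -> R -> 'M[R]_n) (P : 'M[R]_n)
    (s r : R) : 'M[R]_n :=
  if r <= s then Z s 0 *m P *m Z 0 r
  else - (Z s 0 *m (1%:M - P) *m Z 0 r).

Record exp_dichotomy (R : realType) (n : nat) (N : 'cV[R]_n -> R)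
    (Z : R -> R -> 'M[R]_n) (P : 'M[R]_n) (K alpha : R) : Prop := ExpDichotomy {
  dich_proj : P *m P = P ;
  dich_K : 1 <= K ;
  dich_alpha : 0 < alpha ;
  dich_bound : forall s r,
    opnorm N (Zp Z P s r) <= K * expR (- alpha * `|s - r|)
}.

(* Absolute convergence of the sums of G r over r <= k, resp. r >= k. *)
Definition abs_cvg_below (R : realType) (n : nat) (N : 'cV[R]_n -> R)
    (G : int -> 'M[R]_n) (k : int) : Prop :=
  cvgn (series (fun j : nat => opnorm N (G (k - j%:Z)))).

Definition abs_cvg_above (R : realType) (n : nat) (N : 'cV[R]_n -> R)
    (G : int -> 'M[R]_n) (k : int) : Prop :=
  cvgn (series (fun j : nat => opnorm N (G (k + j%:Z)))).

Definition term_plus (R : realType) (n : nat) (t zeta : int -> R)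
    (Phi : R -> 'M[R]_n) (Z : R -> R -> 'M[R]_n) (Q : 'M[R]_n) (r : int)
    : 'M[R]_n :=
  Q *m Z 0 (t r) *m integral_mx (t r) (zeta r) (Phi2 Phi (t r)).

Definition term_minus (R : realType) (n : nat) (t zeta : int -> R)
    (Phi : R -> 'M[R]_n) (Z : R -> R -> 'M[R]_n) (Q : 'M[R]_n) (r : int)
    : 'M[R]_n :=
  Q *m Z 0 (t (r + 1))
    *m integral_mx (zeta r) (t (r + 1)) (Phi2 Phi (t (r + 1))).

(* The common shape of the factors F_0 and F_1. *)
Definition exp_quot (R : realType) (c theta : R) : R :=
  (expR (c * theta) - 1) / (c * theta).

Definition homeomorphism (X Y : topologicalType) (h : X -> Y) : Prop :=
  continuous h /\
  exists g : Y -> X, [/\ continuous g, cancel h g & cancel g h].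

(* Properties (i)-(iii) of a map carrying solutions of the system S1 to
   solutions of the system S2; a system is given by its set of solutions. *)
Record carries (R : realType) (n : nat) (N : 'cV[R]_n -> R)
    (S1 S2 : set (R -> 'cV[R]_n)) (H : R -> 'cV[R]_n -> 'cV[R]_n)
    : Prop := Carries {
  carries_homeo : forall s, homeomorphism (H s) ;
  carries_bounded : exists B : R, forall s u, N (H s u - u) <= B ;
  carries_sol : forall x, S1 x -> S2 (fun s => H s (x s))
}.

Record top_equiv_by (R : realType) (n : nat) (N : 'cV[R]_n -> R)
    (Slin Snonlin : set (R -> 'cV[R]_n))
    (H L : R -> 'cV[R]_n -> 'cV[R]_n) : Prop := TopEquivBy {
  te_inv : forall s, cancel (H s) (L s) /\ cancel (L s) (H s) ;
  te_H : carries N Snonlin Slin H ;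
  te_L : carries N Slin Snonlin L
}.

Record strong_top_equiv_by (R : realType) (n : nat) (N : 'cV[R]_n -> R)
    (Slin Snonlin : set (R -> 'cV[R]_n))
    (H L : R -> 'cV[R]_n -> 'cV[R]_n) : Prop := StrongTopEquivBy {
  ste_te : top_equiv_by N Slin Snonlin H L ;
  ste_H : forall s, unif_continuous (H s) ;
  ste_L : forall s, unif_continuous (L s)
}.

Definition holder_strong_top_equiv (R : realType) (n : nat) (N : 'cV[R]_n -> R)
    (Slin Snonlin : set (R -> 'cV[R]_n)) : Prop :=
  exists H L : R -> 'cV[R]_n -> 'cV[R]_n,
    strong_top_equiv_by N Slin Snonlin H L /\
    exists C1 D1 C2 D2 : R,
      [/\ 1 < C1, 1 < D1, 0 < C2 < 1, 0 < D2 < 1 &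
        forall s : R,
          (forall xi xi', N (xi - xi') < 1 ->
             N (H s xi - H s xi') <= C1 * N (xi - xi') `^ C2) /\
          (forall nu nu', N (nu - nu') < 1 ->
             N (L s nu - L s nu') <= D1 * N (nu - nu') `^ D2)].

(* Main.v *)
(** Call a solution X of the nonlinear system and a solution Y of the linear one
    partners if X - Y is bounded. The dichotomy gives, for a bounded forcing term g, a unique
    bounded solution of z' = A z + A0 z(gamma) + g, obtained by summing the impulses at the
    grid points. A weight exp (beta |s - tau|) on g, with 0 <= beta < alpha, is inherited by z
    with the constant kappa(beta) = 2 K rho* / (alpha - beta). As kappa(0) (l1 + l2) < 1, every
    solution of either system has a partner, and H, L send the value of a solution at
    time t to that of its partner.

    Solutions of either system with initial distance delta separate at most like
    delta exp (p |s - tau|). Interpolating between this and the bound 2 mu on differences of f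
    bounds the latter by C delta^q exp (q p |s - tau|). For q so small that
    beta = q p satisfies kappa(beta) (l1 + l2) exp (beta theta) < 1, the weighted
    estimate turns this into a Hoelder estimate of exponent q for the partners. The case
    delta = 0 shows that partners are unique, so that H and L are well defined and mutually
    inverse. *)

Require Import Defs.
From HB Require Import structures.
From mathcomp Require Import all_boot all_order all_algebra.
From mathcomp Require Import all_classical all_reals all_analysis.
From mathcomp Require Import ring lra zify.

Set Implicit Arguments.
Unset Strict Implicit.
Unset Printing Implicit Defensive.

Import Order.TTheory GRing.Theory Num.Theory.
Import numFieldNormedType.Exports.

Local Open Scope classical_set_scope.
Local Open Scope ring_scope.

(** The contraction condition is stated with the constant 2 K rho* itself, so the impulses must be
    summed without losing a factor. Two facts make this possible. The impulse at t_i is at most rho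
    times zeta_i - zeta_(i-1), up to the weight, so the impulses behave like a Riemann sum of the
    exponential kernel. The discretisation error and the contribution of the current cell then fit
    into the factor exp (alpha theta) of rho*: its part exp ((alpha - beta) theta) pays for the sum,
    its part exp (beta theta) for moving the weight inside one cell.

    Raising the separation to a small power q lowers its rate to q p < alpha, and the boundedness of
    f allows this.

    The forcing f (s, X s, X (gamma s)) jumps at the grid points. It is therefore carried as one
    continuous function for each cell. *)

Ltac mx_ring := apply/matrixP => ? ?; rewrite !mxE; ring.

(** * Norms on column vectors and induced matrix norms *)

Section Norm.
Variables (R : realType) (n : nat) (N : 'cV[R]_n -> R).
Hypothesis hN : is_norm N.

Lemma N0 : N 0 = 0.
Proof. by rewrite -(scale0r 0) (norm_homogeneous hN) normr0 mul0r. Qed.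

Lemma NN x : N (- x) = N x.
Proof. by rewrite -scaleN1r (norm_homogeneous hN) normrN1 mul1r. Qed.

Lemma ND x y : N (x + y) <= N x + N y.
Proof. exact: norm_triangle. Qed.

Lemma NZ a x : N (a *: x) = `|a| * N x.
Proof. exact: norm_homogeneous. Qed.

Lemma N_ge0 x : 0 <= N x.
Proof.
have := ND x (- x); rewrite subrr N0 NN -mulr2n -mulr_natl pmulr_rge0 //.
Qed.

Lemma NBC x y : N (x - y) = N (y - x).
Proof. by rewrite -NN opprB. Qed.

Lemma NB_triangle y x z : N (x - z) <= N (x - y) + N (y - z).
Proof. by apply: le_trans (ND _ _); rewrite addrA subrK. Qed.

Lemma NB x y : N (x - y) <= N x + N y.
Proof. by rewrite -(NN y); exact: ND. Qed.

Lemma N_distl x y : N x - N y <= N (x - y).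
Proof. rewrite lerBlDr; have := ND (x - y) y; by rewrite subrK. Qed.

Lemma N_dist x y : `|N x - N y| <= N (x - y).
Proof. by rewrite ler_norml N_distl andbT lerNl opprB NBC N_distl. Qed.

Lemma N_sum I (r : seq I) (F : I -> 'cV[R]_n) :
  N (\sum_(i <- r) F i) <= \sum_(i <- r) N (F i).
Proof.
elim/big_ind2: _ => [|x1 x2 y1 y2 h1 h2|//]; first by rewrite N0.
exact: le_trans (ND _ _) (lerD h1 h2).
Qed.

Lemma N_le_norm : exists2 C : R, 0 < C & forall x, N x <= C * `|x|.
Proof.
exists (1 + \sum_i N (delta_mx i 0)).
  by rewrite ltr_pwDl// sumr_ge0// => i _; exact: N_ge0.
move=> x; rewrite {1}(matrix_sum_delta x).
apply: le_trans (N_sum _ _) _.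
apply: (@le_trans _ _ (\sum_i `|x| * N (delta_mx i 0))); last first.
  by rewrite -mulr_sumr mulrC ler_wpM2r// ler_wpDl.
apply: ler_sum => i _; rewrite big_ord1 NZ ler_wpM2r ?N_ge0//.
rewrite [leRHS]/Num.norm /= mx_normrE.
exact: (le_bigmax _ (fun ij : 'I_n * 'I_1 => `|x ij.1 ij.2|) (i, 0)).
Qed.

Lemma N_continuous : continuous N.
Proof.
have [C C0 hC] := N_le_norm => x.
apply/(@cvgrPdist_lt _ _ _ _ (nbhs_filter x)) => e e0.
apply/nbhs_ballP; exists (e / C) => [|y] /=; first exact: divr_gt0.
rewrite -ball_normE /ball_ /= ltr_pdivlMr// mulrC.
by apply: le_lt_trans; apply: le_trans (N_dist _ _) (hC _).
Qed.

Lemma norm_trmx m p (x : 'M[R]_(m, p)) : `|x^T| = `|x|.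
Proof.
rewrite /Num.norm /= !mx_normrE.
apply/le_anti/andP; split; apply/bigmax_leP; split=> [|[i j] _ /=];
  try exact: bigmax_ge_id.
  by rewrite mxE; exact: (le_bigmax _ (fun ij => `|x ij.1 ij.2|) (j, i)).
have := le_bigmax 0 (fun ij => `|x^T ij.1 ij.2|) (j, i).
by rewrite /= mxE.
Qed.

(** [N] attains a positive minimum on the unit sphere of the max norm. The sphere is taken in row
    vectors, where [bounded_closed_compact] applies, and the case of an empty sphere (n = 0) is
    split off. *)
Lemma norm_le_N : exists2 c : R, 0 < c & forall x, `|x| <= c * N x.
Proof.
pose S := [set r : 'rV[R]_n | `|r| = 1].
have [S0|/existsNP[r0 /contrapT Sr0]] := pselect (forall r, ~ S r).
  exists 1 => // x; have [->|x0] := eqVneq x 0; first by rewrite normr0 mul1r N_ge0.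
  exfalso; apply: (S0 (`|x|^-1 *: x^T)); rewrite /S /= normrZ norm_trmx normrV.
    by rewrite normr_id mulVf// normr_eq0.
  by rewrite unitfE normr_eq0.
have cS : compact S.
  apply: bounded_closed_compact.
    exists 1; split; first by rewrite num_real.
    by move=> M M1 r; rewrite /S /= => ->; exact: ltW.
  have -> : S = (@Num.norm R 'rV[R]_n) @^-1` [set 1] by [].
  by apply: preimage_closed; [move=> x _; exact: norm_continuous|exact: closed_eq].
have [|r Sr hr] := @compact_EVT_min _ R (fun r => N r^T) S (ex_intro _ r0 Sr0) cS.
  apply: continuous_subspaceT => r.
  apply/(@cvgrPdist_lt _ _ _ _ (nbhs_filter r)) => e e0.
  have [C C0 hC] := N_le_norm.
  apply/nbhs_ballP; exists (e / C) => [|y] /=; first exact: divr_gt0.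
  rewrite -ball_normE /ball_ /= ltr_pdivlMr// mulrC -norm_trmx linearB /=.
  by apply: le_lt_trans; apply: le_trans (N_dist _ _) (hC _).
have {}Sr : `|r| = 1 by rewrite inE in Sr.
have r1 : 0 < N r^T.
  rewrite lt_neqAle N_ge0 andbT eq_sym; apply/eqP => /(norm_definite hN) r0'.
  by move: Sr; rewrite -norm_trmx r0' normr0 => /esym/eqP; rewrite oner_eq0.
exists (N r^T)^-1; first by rewrite invr_gt0.
move=> x; rewrite mulrC ler_pdivlMr//.
have [->|x0] := eqVneq x 0; first by rewrite normr0 mul0r N_ge0.
have x0' : 0 < `|x| by rewrite normr_gt0.
rewrite mulrC -ler_pdivlMr// mulrC.
have := hr (`|x|^-1 *: x^T); rewrite inE linearZ /= trmxK NZ ger0_norm ?invr_ge0//.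
by apply; rewrite /S /= normrZ norm_trmx ger0_norm ?invr_ge0// mulVf// normr_eq0.
Qed.

Lemma N_cvgP (T : Type) (F : set_system T) (FF : Filter F) (u : T -> 'cV[R]_n) (l : 'cV[R]_n) :
  u @ F --> l <-> forall e : R, 0 < e -> \forall x \near F, N (u x - l) < e.
Proof.
have [C C0 hC] := N_le_norm; have [c c0 hc] := norm_le_N.
split=> [/cvgrPdist_lt ul e e0|ul].
  have := ul (e / C) (divr_gt0 e0 C0); apply: filterS => x.
  rewrite ltr_pdivlMr// mulrC distrC; apply: le_lt_trans; exact: hC.
apply/cvgrPdist_lt => e e0; have := ul (e / c) (divr_gt0 e0 c0).
apply: filterS => x; rewrite ltr_pdivlMr// mulrC distrC; apply: le_lt_trans.
exact: hc.
Qed.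

Lemma continuous_normP (X : normedModType R) (u : X -> 'cV[R]_n) (s : X) :
  {for s, continuous u} <->
  forall e : R, 0 < e -> exists2 d : R, 0 < d & forall x, `|x - s| < d -> N (u x - u s) < e.
Proof.
split=> [/N_cvgP us e e0|us].
  have /nbhs_ballP[d /= d0 hd] := us e e0.
  by exists d => // x xs; apply: hd; rewrite -ball_normE /ball_ /= distrC.
apply/N_cvgP => e e0; have [d d0 hd] := us e e0; apply/nbhs_ballP; exists d => //.
by move=> x; rewrite -ball_normE /ball_ /= distrC; exact: hd.
Qed.

(** The first-order expansion without quotients: h = 0 is included, the norm can be exchanged for
    [N], and reflections and shifts become substitutions. *)
Lemma is_deriveP (V : normedModType R) (u : R -> V) (s : R) (v : V) :
  is_derive s (1 : R) u v <->
  forall e : R, 0 < e -> exists2 d : R, 0 < d &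
    forall h : R, `|h| < d -> `|u (h + s) - u s - h *: v| <= e * `|h|.
Proof.
have quot (h : R) : h != 0 ->
    `|v - h^-1 *: (u (h *: (1 : R) + s) - u s)| = `|h|^-1 * `|u (h + s) - u s - h *: v|.
  move=> h0; rewrite distrC -normfV -normrZ [in RHS]scalerBr [h^-1 *: (h *: v)]scalerA.
  by rewrite mulVf// scale1r [h *: (1 : R)]mulr1.
split=> [|H].
  move=> [du Du]; have : h^-1 *: (u (h *: (1 : R) + s) - u s) @[h --> 0^'] --> v.
    by rewrite -Du.
  move=> /cvgrPdist_lt H e e0; have /nbhs_ballP[d /= d0 hd] := H e e0.
  exists d => // h hd'; have [->|h0] := eqVneq h 0.
    by rewrite add0r subrr scale0r subrr !normr0 mulr0.
  have := hd h; rewrite -ball_normE /ball_ /= sub0r normrN => /(_ hd' h0).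
  by rewrite quot// mulrC ltr_pdivrMr ?normr_gt0// => /ltW.
have cv : h^-1 *: (u (h *: (1 : R) + s) - u s) @[h --> 0^'] --> v.
  apply/cvgrPdist_lt => e e0; have [d d0 hd] := H (e / 2) (divr_gt0 e0 (ltr0Sn _ _)).
  apply/nbhs_ballP; exists d => // h.
  rewrite -ball_normE /ball_ /= sub0r normrN => hd' h0.
  rewrite quot// mulrC ltr_pdivrMr ?normr_gt0//; apply: le_lt_trans (hd _ hd') _.
  by rewrite ltr_pM2r ?normr_gt0// ltr_pdivrMr// ltr_pMr// ltr1n.
by split; [apply/cvg_ex; exists v|apply/cvg_lim => //; exact: norm_hausdorff].
Qed.

Lemma is_derive_normP (u : R -> 'cV[R]_n) (s : R) (v : 'cV[R]_n) :
  is_derive s (1 : R) u v <->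
  forall e : R, 0 < e -> exists2 d : R, 0 < d &
    forall h : R, `|h| < d -> N (u (h + s) - u s - h *: v) <= e * `|h|.
Proof.
have [C C0 hC] := N_le_norm; have [c c0 hc] := norm_le_N.
split=> [/is_deriveP H|H].
  move=> e e0; have [d d0 hd] := H (e / C) (divr_gt0 e0 C0).
  exists d => // h /hd; rewrite mulrAC ler_pdivlMr// mulrC; exact: le_trans.
apply/is_deriveP => e e0; have [d d0 hd] := H (e / c) (divr_gt0 e0 c0).
exists d => // h /hd; rewrite mulrAC ler_pdivlMr// mulrC; exact: le_trans.
Qed.

Lemma norm_mulmx_le (B : 'M[R]_n) (x : 'cV[R]_n) : `|B *m x| <= n%:R * `|B| * `|x|.
Proof.
have ub m p (M : 'M[R]_(m, p)) i j : `|M i j| <= `|M|.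
  by rewrite {2}/Num.norm /= mx_normrE; exact: (le_bigmax _ (fun ij => `|M ij.1 ij.2|) (i, j)).
rewrite {1}/Num.norm /= mx_normrE; apply/bigmax_leP; split => [|[i j] _ /=].
  by rewrite !mulr_ge0.
rewrite mxE; apply: le_trans (ler_norm_sum _ _ _) _.
apply: (@le_trans _ _ (\sum_(k < n) `|B| * `|x|)).
  by apply: ler_sum => k _; rewrite normrM ler_pM// ub.
by rewrite sumr_const card_ord -mulrA mulr_natl.
Qed.

Lemma N_mulmx_le : exists2 c : R, 0 < c & forall (B : 'M[R]_n) x, N (B *m x) <= c * `|B| * N x.
Proof.
have [C C0 hC] := N_le_norm; have [c c0 hc] := norm_le_N.
exists (C * (n%:R + 1) * c); first by rewrite !mulr_gt0// ltr_wpDl.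
move=> B x; apply: le_trans (hC _) _.
rewrite -!mulrA ler_pM2l//; apply: le_trans (norm_mulmx_le _ _) _.
rewrite -mulrA ler_pM//; first by rewrite lerDl.
by rewrite mulrCA ler_wpM2l.
Qed.

Local Notation opset B := [set N (B *m x) | x in [set x | N x <= 1]].

Lemma opset_sup (B : 'M[R]_n) : has_sup (opset B).
Proof.
split; first by exists (N (B *m 0)), 0; rewrite //= N0.
have [c c0 hc] := N_mulmx_le; exists (c * `|B|) => _ [x x1 <-].
by apply: le_trans (hc _ _) _; rewrite ler_piMr// mulr_ge0// ltW.
Qed.

Lemma opnorm_ge0 (B : 'M[R]_n) : 0 <= opnorm N B.
Proof.
apply: (@le_trans _ _ (N (B *m 0))); first exact: N_ge0.
by apply: sup_upper_bound; [exact: opset_sup|exists 0; rewrite //= N0].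
Qed.

Lemma opnorm_le (B : 'M[R]_n) x : N (B *m x) <= opnorm N B * N x.
Proof.
have [/eqP x0|x0] := eqVneq (N x) 0.
  by have -> := norm_definite hN (eqP x0); rewrite mulmx0 N0 mulr0.
have x0' : 0 < N x by rewrite lt_neqAle eq_sym x0 N_ge0.
rewrite -ler_pdivrMr// mulrC -[(N x)^-1]ger0_norm ?invr_ge0 ?N_ge0//.
rewrite -NZ scalemxAr; apply: sup_upper_bound; first exact: opset_sup.
by exists ((N x)^-1 *: x) => //=; rewrite NZ ger0_norm ?invr_ge0 ?N_ge0// mulVf.
Qed.

Lemma opnorm_ub (B : 'M[R]_n) c :
  0 <= c -> (forall x, N (B *m x) <= c * N x) -> opnorm N B <= c.
Proof.
move=> c0 hc; apply: ge_sup; first by have [] := opset_sup B.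
by move=> _ [x x1 <-]; apply: le_trans (hc _) _; rewrite ler_piMr.
Qed.

Lemma opnorm_continuous (A : R -> 'M[R]_n) : continuous A ->
  continuous (fun s => opnorm N (A s)).
Proof.
move=> cA s; have [c c0 hc] := N_mulmx_le.
have tri (B D : 'M[R]_n) : opnorm N B - opnorm N D <= c * `|B - D|.
  rewrite lerBlDr; apply: opnorm_ub => [|x].
    by rewrite addr_ge0 ?opnorm_ge0// mulr_ge0// ltW.
  rewrite -{1}(subrK D B) mulmxDl mulrDl; apply: le_trans (ND _ _) _.
  by rewrite lerD// opnorm_le.
apply/cvgrPdist_lt => e e0.
have /cvgrPdist_lt/(_ (e / c) (divr_gt0 e0 c0)) := cA s.
apply: filterS => r; rewrite ltr_pdivlMr// mulrC; apply: le_lt_trans.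
by rewrite ler_norml lerNl opprB tri distrC tri.
Qed.

End Norm.

(** * Primitives of continuous functions on the whole line *)

Section Primitive.
Variable R : realType.
Local Notation mu := (@lebesgue_measure R).

Lemma primitive_Rintegral (f F : R -> R) (a b : R) : a <= b ->
  continuous f -> (forall s, is_derive s (1 : R) F (f s)) ->
  \int[mu]_(s in `[a, b]) f s = F b - F a.
Proof.
move=> ab cf dF; move: ab; rewrite le_eqVlt => /predU1P[->|ab].
  by rewrite set_itv1 Rintegral_set1 subrr.
rewrite /Rintegral (continuous_FTC2 (F := F))//.
- exact: continuous_subspaceT.
- have cF : continuous F by move=> x; apply: differentiable_continuous; apply/derivable1_diffP; have [] := dF x.
  split; [by move=> x _; have [] := dF x| |].
  + exact/cvg_at_right_filter/cF.
  + exact/cvg_at_left_filter/cF.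
- by move=> x _; rewrite derive1E; have [] := dF x.
Qed.

(** The integral from a base point a is differentiable only to the right of a. So the base point of
    [G] recedes with |x|, and by [GE] any a far enough to the left gives the same values; near s a
    single a serves. *)
Lemma primitive (f : R -> R) : continuous f ->
  exists F : R -> R, forall s, is_derive s (1 : R) F (f s).
Proof.
move=> cf.
pose F (a x : R) := \int[mu]_(t in `[a, x]) f t.
have intf a b : mu.-integrable `[a, b] (EFin \o f).
  by apply: continuous_compact_integrable; [exact: segment_compact|exact: continuous_subspaceT].
have dF (a x : R) : a < x -> is_derive x (1 : R) (F a) (f x).
  move=> ax; have [] := @continuous_FTC1_closed _ f a x (x + 1) _ (intf _ _) ax (cf x).
    by rewrite ltrDl.
  by move=> d; rewrite derive1E => <-; split.
have shift (a b x : R) : a <= b -> b <= x -> F a x = F a b + F b x.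
  move=> ab bx; have /= := @Rintegral_itvB _ f (BLeft a) (BRight x) b (intf a x).
  rewrite !bnd_simp => /(_ ab bx); rewrite Rintegral_itv_obnd_cbnd.
    by rewrite /F => <-; rewrite addrC subrK.
  by apply: integrableS (intf b x) => //; apply: subset_itvr; rewrite bnd_simp.
pose G x := F (- (`|x| + 1)) x - F (- (`|x| + 1)) 0.
have GE (a x : R) : a <= - (`|x| + 1) -> G x = F a x - F a 0.
  move=> ax; have := ler_norm (- x); have := normr_ge0 x; rewrite normrN => x0 xx.
  by rewrite (shift a (- (`|x| + 1)) x)// ?(shift a (- (`|x| + 1)) 0)// /G; lra.
exists G => s; set a := - (`|s| + 2).
have as_ : a < s by rewrite /a; have := ler_norm (- s); rewrite normrN; lra.
apply: (@near_eq_is_derive _ _ _ (fun x => F a x - F a 0)).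
  apply/nbhs_ballP; exists (1 : R) => [|y]; first exact: ltr01.
  rewrite -ball_normE /ball_ /= => sy.
  rewrite (GE a)// /a.
  have := ler_normB s (s - y); rewrite subKr; lra.
rewrite -[f s]subr0; apply: is_deriveB; exact: dF.
Qed.

Lemma primitive_mx m n (g : R -> 'M[R]_(m, n)) : continuous g ->
  exists G : R -> 'M[R]_(m, n), forall s, is_derive s (1 : R) G (g s).
Proof.
move=> cg.
have /choice[F hF] (ij : 'I_m * 'I_n) :
    exists F : R -> R, forall s, is_derive s (1 : R) F (g s ij.1 ij.2).
  apply: primitive => s; apply: (@continuous_comp _ _ _ g (fun M => M ij.1 ij.2)).
    exact: cg.
  exact: coord_continuous.
pose G s := \matrix_(i, j) F (i, j) s : 'M[R]_(m, n).
exists G => s.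
have GE i j : (fun x => G x i j) = F (i, j) by apply/funext => x; rewrite mxE.
have dG : derivable G s (1 : R).
  by apply/derivable_mxP => i j; rewrite GE; have [] := hF (i, j) s.
split=> //; rewrite derive_mx//; apply/matrixP => i j; rewrite mxE GE.
by have [] := hF (i, j) s.
Qed.

End Primitive.

(** * Comparison principles and global solutions of ordinary differential equations *)

Section Comparison.
Variables (R : realType) (n : nat) (N : 'cV[R]_n -> R).
Hypothesis hN : is_norm N.

Lemma is_derive_continuous (V : normedModType R) (u u' : R -> V) :
  (forall s, is_derive s (1 : R) u (u' s)) -> continuous u.
Proof.
by move=> du s; apply: differentiable_continuous; apply/derivable1_diffP; have [] := du s.
Qed.

Lemma continuous_pos_nbhs (h : R -> R) (m : R) : {for m, continuous h} -> 0 < h m ->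
  exists2 d : R, 0 < d & forall s, `|s - m| < d -> 0 < h s.
Proof.
move=> ch hm; have /cvgrPdist_lt/(_ _ hm) := ch.
move=> /nbhs_ballP[d /= d0 hd]; exists d => // s sm.
have := hd s; rewrite -ball_normE /ball_ /= distrC => /(_ sm).
by rewrite ltr_norml; lra.
Qed.

Lemma comparison (d d' : R -> 'cV[R]_n) (k b W W' : R -> R) (a c : R) :
  continuous d -> (forall s, a < s < c -> is_derive s (1 : R) d (d' s)) ->
  (forall s, a < s < c -> N (d' s) <= k s * N (d s) + b s) ->
  (forall s, is_derive s (1 : R) W (W' s)) ->
  (forall s, a < s < c -> k s * W s + b s < W' s) ->
  N (d a) < W a -> forall s, a <= s <= c -> N (d s) <= W s.
Proof.
move=> cd dd Nd' dW kW Wa.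
(* At a first zero m of h, W' m > N (d' m) would make h negative just before m. *)
pose h s := W s - N (d s).
have ch : continuous h.
  move=> s; apply: continuousB; first exact: (is_derive_continuous dW).
  by apply: continuous_comp; [exact: cd|exact: N_continuous].
have ha : 0 < h a by rewrite subr_gt0.
(* The differential inequality holds only inside the interval, so the endpoint c is reached by
   continuity. *)
suff main s : a <= s < c -> 0 < h s.
  move=> s /andP[as_]; rewrite le_eqVlt => /predU1P[sc|sc]; last first.
    by have := main s; rewrite as_ sc subr_gt0 => /(_ isT)/ltW.
  rewrite leNgt -subr_gt0; apply/negP => hs.
  have [e e0 he] := @continuous_pos_nbhs (fun s => - h s) s (continuousN (ch s)) ltac:(rewrite /h; lra).
  have as' : a < s.
    rewrite lt_neqAle as_ andbT; apply/eqP => as'; move: ha; rewrite as' /h; lra.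
  have := he (Num.max a (s - e / 2)); have := main (Num.max a (s - e / 2)).
  rewrite ltr_norml; case: (leP a (s - e / 2)) => H H1 H2.
    by have := H1 ltac:(lra); have := H2 ltac:(lra); lra.
  by have := H1 ltac:(lra); have := H2 ltac:(lra); lra.
move=> /andP[as_ sc]; rewrite ltNge; apply/negP => hs.
pose E := [set r | a <= r <= s /\ h r <= 0].
have Es : E s by split; rewrite ?as_ ?lexx.
have infE : has_inf E by split; [exists s|exists a => r [/andP[]]].
set m := inf E.
have ms : m <= s by apply: ge_inf => //; have [] := infE.
have am : a <= m by apply: lb_le_inf; [exists s|move=> r [/andP[]]].
have below r : a <= r -> r < m -> 0 < h r.
  move=> ar rm; rewrite ltNge; apply/negP => hr.
  have : m <= r by apply: ge_inf; [have [] := infE|split=> //; rewrite ar (le_trans (ltW rm))].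
  by rewrite leNgt rm.
have hm0 : h m <= 0.
  rewrite leNgt; apply/negP => hm.
  have [e e0 he] := continuous_pos_nbhs (ch m) hm.
  have [r [Er1 Er2] rm] := inf_adherent e0 infE; rewrite -/m in rm.
  have mr : m <= r by apply: ge_inf; [have [] := infE|split].
  by have := he r; rewrite ltr_norml => /(_ ltac:(lra)); lra.
have am' : a < m.
  by rewrite lt_neqAle am andbT; apply/eqP => am'; move: ha; rewrite am'; lra.
have hm : h m = 0.
  apply/eqP; rewrite eq_le hm0 leNgt; apply/negP => hm.
  have [e e0 he] := @continuous_pos_nbhs (fun s => - h s) m (continuousN (ch m)) ltac:(rewrite /=; lra).
  have := he (Num.max a (m - e / 2)); have := below (Num.max a (m - e / 2)).
  rewrite ltr_norml; case: (leP a (m - e / 2)) => H H1 H2.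
    by have := H1 ltac:(lra) ltac:(lra); have := H2 ltac:(lra); lra.
  by have := H1 ltac:(lra) ltac:(lra); have := H2 ltac:(lra); lra.
have mac : a < m < c by rewrite am' (le_lt_trans ms).
have gap : N (d' m) < W' m.
  apply: le_lt_trans (Nd' m mac) _; have := kW m mac.
  by have -> : W m = N (d m) by move: hm; rewrite /h; lra.
pose e := (W' m - N (d' m)) / 4.
have e0 : 0 < e by rewrite divr_gt0// subr_gt0.
have [d1 d10 hd1] := (is_deriveP W m (W' m)).1 (dW m) e e0.
have [d2 d20 hd2] := (is_derive_normP hN d m (d' m)).1 (dd m mac) e e0.
pose x := Num.min (m - a) (Num.min d1 d2) / 2.
have x0 : 0 < x by rewrite divr_gt0// !lt_min subr_gt0 am' d10 d20.
have [x1 x2 x3] : [/\ x < m - a, x < d1 & x < d2].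
  have : x * 2 <= Num.min (m - a) (Num.min d1 d2) by rewrite divfK.
  by rewrite !le_min => /and3P[? ? ?]; split; lra.
have /hd1 : `|- x| < d1 by rewrite normrN gtr0_norm.
have /hd2 : `|- x| < d2 by rewrite normrN gtr0_norm.
rewrite normrN gtr0_norm// ler_norml => h2 /andP[h11 h12].
(* [N] need not be differentiable. The triangle inequality applied to the expansion of [d] at m
   stands in for a derivative of N (d s). *)
have h3 : N (d m) - x * N (d' m) <= N (d (- x + m)) + e * x.
  have := N_distl hN (d m - x *: d' m) (d (- x + m)).
  have -> : N (d m - x *: d' m - d (- x + m)) = N (d (- x + m) - d m - (- x) *: d' m).
    by rewrite -(NN hN); congr N; mx_ring.
  have := N_distl hN (d m) (x *: d' m); rewrite (NZ hN) (gtr0_norm x0); lra.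
have := below (- x + m) ltac:(lra) ltac:(lra); rewrite /h.
have ex : e * 4 = W' m - N (d' m) by rewrite divfK.
move: h12; rewrite /GRing.scale /= => h12.
have : W m = N (d m) by move: hm; rewrite /h; lra.
have : 0 < e * x by exact: mulr_gt0.
have : x * (e * 4) = x * W' m - x * N (d' m) by rewrite ex; ring.
have : x * (e * 4) = 4 * (e * x) by ring.
lra.
Qed.

End Comparison.

Section Gronwall.
Variables (R : realType) (n : nat) (N : 'cV[R]_n -> R).
Hypothesis hN : is_norm N.

Lemma is_derive_funD (V : normedModType R) (f g : R -> V) (s : R) (v w : V) :
  is_derive s (1 : R) f v -> is_derive s (1 : R) g w ->
  is_derive s (1 : R) (fun r => f r + g r) (v + w).
Proof. by move=> hf hg; exact: (@is_deriveD _ _ _ f g s 1 v w hf hg). Qed.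

Lemma is_derive_funB (V : normedModType R) (f g : R -> V) (s : R) (v w : V) :
  is_derive s (1 : R) f v -> is_derive s (1 : R) g w ->
  is_derive s (1 : R) (fun r => f r - g r) (v - w).
Proof. by move=> hf hg; exact: (@is_deriveB _ _ _ f g s 1 v w hf hg). Qed.

Lemma is_derive_addl (V : normedModType R) (c : V) (f : R -> V) (s : R) (v : V) :
  is_derive s (1 : R) f v -> is_derive s (1 : R) (fun r => c + f r) v.
Proof.
move=> hf; rewrite -[v]add0r.
exact: (@is_derive_funD V (cst c) f s 0 v (is_derive_cst _ _ _) hf).
Qed.

Lemma is_derive_subr (V : normedModType R) (c : V) (f : R -> V) (s : R) (v : V) :
  is_derive s (1 : R) f v -> is_derive s (1 : R) (fun r => f r - c) v.
Proof.
move=> hf; rewrite -[v]subr0.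
exact: (@is_derive_funB V f (cst c) s v 0 hf (is_derive_cst _ _ _)).
Qed.

Lemma is_derive_funM (f g : R -> R) (s v w : R) :
  is_derive s (1 : R) f v -> is_derive s (1 : R) g w ->
  is_derive s (1 : R) (fun r => f r * g r) (v * g s + f s * w).
Proof.
move=> hf hg; have := @is_deriveM _ _ f g s 1 v w hf hg.
by rewrite /GRing.scale /= addrC (mulrC (g s)).
Qed.

Lemma is_derive_scalel (f : R -> R) (a s v : R) :
  is_derive s (1 : R) f v -> is_derive s (1 : R) (fun r => a * f r) (a * v).
Proof. by move=> hf; exact: (@is_deriveZ _ _ _ f a s 1 v hf). Qed.

Lemma is_derive_expR_comp (f : R -> R) (s v : R) :
  is_derive s (1 : R) f v -> is_derive s (1 : R) (fun r => expR (f r)) (v * expR (f s)).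
Proof.
move=> hf; have := @is_derive1_comp _ expR f s (expR (f s)) v (is_derive_expR _) hf.
by rewrite mulrC.
Qed.

Lemma is_derive_expM (a s : R) :
  is_derive s (1 : R) (fun s => expR (a * s)) (a * expR (a * s)).
Proof.
apply: is_derive_expR_comp; have := is_derive_scalel a (is_derive_id s (1 : R)).
by rewrite mulr1.
Qed.

(** Adding a multiple of exp ((M + 1) s) to [W] makes both inequalities strict, because k <= M. The
    multiple is normalised to contribute exactly e at the point s under consideration. *)
Lemma comparison_right (d d' : R -> 'cV[R]_n) (k b W W' : R -> R) (M a c : R) :
  continuous d -> (forall s, a < s < c -> is_derive s (1 : R) d (d' s)) ->
  (forall s, a < s < c -> N (d' s) <= k s * N (d s) + b s) ->
  (forall s, k s <= M) ->
  (forall s, is_derive s (1 : R) W (W' s)) ->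
  (forall s, a < s < c -> k s * W s + b s <= W' s) ->
  N (d a) <= W a -> forall s, a <= s <= c -> N (d s) <= W s.
Proof.
move=> cd dd Nd' kM dW kW Wa s sac; apply/ler_addgt0Pr => e e0.
pose E := expR ((M + 1) * s); have E0 : 0 < E by exact: expR_gt0.
have := @comparison _ _ _ hN d d' k b (fun s => W s + e / E * expR ((M + 1) * s))
  (fun s => W' s + e / E * ((M + 1) * expR ((M + 1) * s))) a c cd dd Nd'.
rewrite -/E => /(_ _ _ _ s sac).
rewrite -/E divfK ?gt_eqF//; apply.
- move=> r; apply: (is_derive_funD (dW r)).
  by apply: is_derive_scalel; exact: is_derive_expM.
- move=> r rac; have := kW r rac.
  have : 0 < e / E * expR ((M + 1) * r) by rewrite mulr_gt0 ?divr_gt0// expR_gt0.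
  set y := e / E * _ => y0.
  have -> : e / E * ((M + 1) * expR ((M + 1) * r)) = M * y + y by rewrite /y; ring.
  have : k r * y <= M * y by rewrite ler_pM2r.
  by rewrite mulrDr; lra.
- by rewrite (le_lt_trans Wa)// ltrDl mulr_gt0 ?divr_gt0// expR_gt0.
Qed.

Lemma is_derive_reflect (V : normedModType R) (u : R -> V) (s : R) (v : V) :
  is_derive (- s) (1 : R) u v -> is_derive s (1 : R) (fun r => u (- r)) (- v).
Proof.
move=> /is_deriveP H; apply/is_deriveP => e e0; have [d d0 hd] := H e e0.
exists d => // h hh; have := hd (- h); rewrite normrN => /(_ hh).
by rewrite opprD scalerN scaleNr.
Qed.

Lemma comparison_left (d d' : R -> 'cV[R]_n) (k b W W' : R -> R) (M a c : R) :
  continuous d -> (forall s, c < s < a -> is_derive s (1 : R) d (d' s)) ->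
  (forall s, c < s < a -> N (d' s) <= k s * N (d s) + b s) ->
  (forall s, k s <= M) ->
  (forall s, is_derive s (1 : R) W (W' s)) ->
  (forall s, c < s < a -> k s * W s + b s <= - W' s) ->
  N (d a) <= W a -> forall s, c <= s <= a -> N (d s) <= W s.
Proof.
move=> cd dd Nd' kM dW kW Wa s sca.
have := @comparison_right (fun s => d (- s)) (fun s => - d' (- s)) (fun s => k (- s))
  (fun s => b (- s)) (fun s => W (- s)) (fun s => - W' (- s)) M (- a) (- c).
move=> /(_ _ _ _ _ _ _ _ (- s)); rewrite !opprK; apply => //.
- by move=> r; apply: continuous_comp; [exact: opp_continuous|exact: cd].
- by move=> r rac; apply: is_derive_reflect; apply: dd; lra.
- by move=> r rac; rewrite (NN hN); apply: Nd'; lra.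
- by move=> r; apply: is_derive_reflect; exact: dW.
- by move=> r rac; apply: kW; lra.
- by lra.
Qed.

Lemma is_derive_shiftr (f : R -> R) (c s v : R) :
  is_derive (s - c) (1 : R) f v -> is_derive s (1 : R) (fun r => f (r - c)) v.
Proof.
move=> /is_deriveP H; apply/is_deriveP => e e0; have [d d0 hd] := H e e0.
by exists d => // h hh; have := hd h hh; rewrite addrA.
Qed.

(** Forward and backward comparison in one statement, with a majorant in the distance to a. Of the
    two alternatives in each hypothesis, at most one can occur for given a and c. *)
Lemma comparison_dist (d d' : R -> 'cV[R]_n) (k b W W' : R -> R) (M a c : R) :
  continuous d ->
  (forall s, (a < s < c) || (c < s < a) -> is_derive s (1 : R) d (d' s)) ->
  (forall s, (a < s < c) || (c < s < a) -> N (d' s) <= k s * N (d s) + b s) ->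
  (forall s, k s <= M) ->
  (forall s, is_derive s (1 : R) W (W' s)) ->
  (forall s, (a < s < c) || (c < s < a) ->
     k s * W `|s - a| + b s <= W' `|s - a|) ->
  N (d a) <= W 0 -> N (d c) <= W `|c - a|.
Proof.
move=> cd dd Nd' kM dW kW Wa.
have [ac|ca] := leP a c.
  rewrite ger0_norm ?subr_ge0//.
  apply: (@comparison_right d d' k b (fun s => W (s - a)) (fun s => W' (s - a)) M a c);
    rewrite ?lexx ?ac ?subrr//.
  - by move=> s sac; apply: dd; rewrite sac.
  - by move=> s sac; apply: Nd'; rewrite sac.
  - by move=> s; apply: is_derive_shiftr; exact: dW.
  - move=> s sac; have := kW s; rewrite sac => /(_ isT).
    by rewrite ger0_norm//; lra.
rewrite ltr0_norm ?subr_lt0// opprB.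
apply: (@comparison_left d d' k b (fun s => W (a - s)) (fun s => - W' (a - s)) M a c);
  rewrite ?lexx ?(ltW ca) ?subrr//.
- by move=> s sac; apply: dd; rewrite sac orbT.
- by move=> s sac; apply: Nd'; rewrite sac orbT.
- move=> s; have := @is_derive_reflect _ (fun r => W (r - - a)) s (W' (a - s)).
  have -> : (fun r => W (- r - - a)) = (fun s => W (a - s)).
    by apply/funext => r; congr W; ring.
  by apply; apply: is_derive_shiftr; rewrite opprK addrC; exact: dW.
- move=> s sac; have := kW s; rewrite sac orbT => /(_ isT).
  by rewrite opprK ler0_norm ?opprB//; lra.
Qed.

Lemma gronwall (d d' : R -> 'cV[R]_n) (k b a c : R) : 0 < k ->
  continuous d ->
  (forall s, (a < s < c) || (c < s < a) -> is_derive s (1 : R) d (d' s)) ->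
  (forall s, (a < s < c) || (c < s < a) -> N (d' s) <= k * N (d s) + b) ->
  N (d c) <= expR (k * `|c - a|) * N (d a) + b * ((expR (k * `|c - a|) - 1) / k).
Proof.
move=> k0 cd dd Nd'.
apply: (@comparison_dist d d' (fun=> k) (fun=> b)
   (fun h => expR (k * h) * N (d a) + b * ((expR (k * h) - 1) / k))
   (fun h => (k * expR (k * h)) * N (d a) + b * expR (k * h)) k a c) => //.
- move=> h; have de := is_derive_expM k h.
  apply: is_derive_funD; first by under eq_fun do rewrite mulrC; rewrite mulrC; exact: is_derive_scalel.
  apply: is_derive_scalel; under eq_fun do rewrite mulrC.
  have -> : expR (k * h) = k^-1 * (k * expR (k * h) - 0).
    by rewrite subr0 mulKf// gt_eqF.
  apply: is_derive_scalel; apply: (is_derive_funB de); exact: is_derive_cst.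
- move=> s _; rewrite le_eqVlt; apply/orP; left; apply/eqP.
  by field; rewrite gt_eqF.
- by rewrite mulr0 expR0 subrr mul0r mulr0 addr0 mul1r.
Qed.

End Gronwall.

(** * Fixed points in weighted sup norms *)

Section FixedPoint.
Variables (R : realType) (n : nat) (N : 'cV[R]_n -> R).
Hypothesis hN : is_norm N.

(** [b] decreases and is bounded below, hence is Cauchy even if it does not tend to 0. The same [b]
    then bounds the distance to the limit, for geometric iterations as well as for the impulse
    series. *)
Lemma N_telescope_cvg (x : nat -> 'cV[R]_n) (b : nat -> R) :
  (forall k, N (x k.+1 - x k) <= b k - b k.+1) -> (forall k, 0 <= b k) ->
  exists l : 'cV[R]_n, (x @ \oo --> l) /\ forall k, N (l - x k) <= b k.
Proof.
move=> xb b0.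
have xbm k m : N (x (k + m)%N - x k) <= b k - b (k + m)%N.
  elim: m => [|m IH]; first by rewrite addn0 !subrr (N0 hN).
  apply: le_trans (NB_triangle hN (x (k + m)%N) _ _) _.
  by have := xb (k + m)%N; rewrite addnS; move: IH; lra.
have [c c0 hc] := norm_le_N hN.
have infb : has_inf (range b).
  by split; [exists (b 0%N), 0%N|exists 0 => _ [k _ <-]].
have cx : cvg (x @ \oo).
  apply/cauchy_cvgP/cauchy_exP => e e0.
  have [_ [k _ <-] bk] := inf_adherent (divr_gt0 e0 c0) infb.
  exists (x k); exists k => // m /= km; rewrite -ball_normE /ball_ /=.
  apply: le_lt_trans (hc _) _; rewrite mulrC -ltr_pdivlMr// (NBC hN) -(subnKC km).
  apply: le_lt_trans (xbm _ _) _.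
  have : inf (range b) <= b (k + (m - k))%N by apply: ge_inf; [have [] := infb|exists (k + (m - k))%N].
  by move: bk; lra.
have [l xl] := (cvg_ex _).1 cx; exists l; split=> // k.
apply/ler_addgt0Pr => e e0.
have /(N_cvgP hN _ _ _).1/(_ e e0)[m _ hm] := xl.
have := hm (k + m)%N (leq_addl _ _); rewrite (NBC hN) => h.
apply: le_trans (NB_triangle hN (x (k + m)%N) _ _) _.
by have := xbm k m; have := b0 (k + m)%N; move: h; lra.
Qed.

(** Banach's theorem for the sup norm with weight [w], carried out pointwise so that no complete
    function space is needed. [S] holds side conditions such as continuity and must be closed only
    under geometric convergence. Elements of [S] may have infinite weighted norm; only the first
    step from [u0] must be finite. *)
Lemma weighted_fixpoint (T : Type) (w : T -> R) (S : set (T -> 'cV[R]_n))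
    (Op : (T -> 'cV[R]_n) -> T -> 'cV[R]_n) (q C0 : R) (u0 : T -> 'cV[R]_n) :
  0 < q < 1 -> (forall s, 0 <= w s) -> 0 <= C0 ->
  (forall u, S u -> S (Op u)) ->
  (forall u v C, 0 <= C -> S u -> S v -> (forall s, N (u s - v s) <= C * w s) ->
     forall s, N (Op u s - Op v s) <= q * C * w s) ->
  (forall us u C, 0 <= C -> (forall k, S (us k)) ->
     (forall k s, N (u s - us k s) <= C * q ^+ k * w s) -> S u) ->
  S u0 -> (forall s, N (Op u0 s - u0 s) <= C0 * w s) ->
  exists2 u, S u & forall s, Op u s = u s.
Proof.
move=> /andP[q0 q1] w0 C00 SOp cOp clS Su0 hu0.
have qk k : 0 <= q ^+ k by apply: exprn_ge0; exact: ltW.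
pose us k := iter k Op u0.
have Sus k : S (us k) by elim: k => //= k; exact: SOp.
have step k s : N (us k.+1 s - us k s) <= C0 * q ^+ k * w s.
  elim: k s => [|k IH] s; first by rewrite expr0 mulr1; exact: hu0.
  rewrite exprS mulrCA.
  exact: (cOp _ _ _ (mulr_ge0 C00 (qk k)) (Sus k.+1) (Sus k) IH s).
pose C := C0 / (1 - q); have C_ge0 : 0 <= C by rewrite divr_ge0// subr_ge0 ltW.
have /choice[u hu] s : exists l : 'cV[R]_n, forall k, N (l - us k s) <= C * q ^+ k * w s.
  have [||l [_ hl]] := @N_telescope_cvg (us ^~ s) (fun k => C * q ^+ k * w s); last by exists l => k.
    move=> k; apply: le_trans (step k s) _.
    rewrite -mulrBl exprS le_eqVlt; apply/orP; left; apply/eqP; rewrite /C.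
    by field; rewrite subr_eq0 gt_eqF.
  by move=> k; exact: (mulr_ge0 (mulr_ge0 C_ge0 (qk k)) (w0 s)).
have Su : S u by apply: (clS us u C) => // k s; exact: hu.
exists u => // s; apply/eqP; rewrite -subr_eq0; apply/eqP/(norm_definite hN).
apply/eqP; rewrite eq_le (N_ge0 hN) andbT.
have B k : N (Op u s - u s) <= (2 * C * w s * q) * q ^+ k.
  apply: le_trans (NB_triangle hN (us k.+1 s) _ _) _.
  have h1 : N (Op u s - us k.+1 s) <= q * (C * q ^+ k) * w s.
    exact: (cOp u (us k) _ (mulr_ge0 C_ge0 (qk k)) Su (Sus k) (hu^~ k) s).
  have := hu s k.+1; rewrite (NBC hN (u s)) exprS => h2.
  apply: le_trans (lerD h1 h2) _; rewrite le_eqVlt; apply/orP; left; apply/eqP; ring.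
apply/ler_addgt0Pr => e e0; rewrite add0r.
have c0 : 0 <= 2 * C * w s * q by rewrite (mulr_ge0 (mulr_ge0 (mulr_ge0 _ C_ge0) (w0 s)) (ltW q0)).
have : (fun k => (2 * C * w s * q) * q ^+ k) @ \oo --> 2 * C * w s * q * 0.
  by apply: cvgMr; apply: cvg_expr; rewrite ger0_norm// ltW.
rewrite mulr0 => /cvgrPdist_lt/(_ e e0)[m _ /(_ m (leqnn m))] /=.
rewrite sub0r normrN (ger0_norm (mulr_ge0 c0 (qk m))) => h.
exact: le_trans (B m) (ltW h).
Qed.

End FixedPoint.

(** * Global solutions of Lipschitz equations *)

Section GlobalOde.
Variables (R : realType) (n : nat) (N : 'cV[R]_n -> R).
Hypothesis hN : is_norm N.

(** A continuous weight is locally bounded, here by w s + 1 near s, so the convergence is locally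
    uniform. *)
Lemma weighted_limit_continuous (w : R -> R) (us : nat -> R -> 'cV[R]_n)
    (u : R -> 'cV[R]_n) (C q : R) :
  continuous w -> (forall s, 0 <= w s) -> 0 <= C -> 0 < q < 1 ->
  (forall k, continuous (us k)) ->
  (forall k s, N (u s - us k s) <= C * q ^+ k * w s) -> continuous u.
Proof.
move=> cw w0 C0 /andP[q0 q1] cus hu s; apply/(continuous_normP hN) => e e0.
have cws : {for s, continuous (fun r => w s + 1 - w r)}.
  by apply: cvgB; [exact: cvg_cst|exact: cw].
have [d d0 hd] := continuous_pos_nbhs cws ltac:(rewrite /=; lra).
have : (fun k => C * (w s + 1) * q ^+ k) @ \oo --> C * (w s + 1) * 0.
  by apply: cvgMr; apply: cvg_expr; rewrite ger0_norm// ltW.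
rewrite mulr0 => /cvgrPdist_lt/(_ (e / 4) (divr_gt0 e0 (ltr0Sn _ _)))[k _ /(_ k (leqnn k))] /=.
have ws := w0 s.
have Cq : 0 <= C * q ^+ k by rewrite mulr_ge0// exprn_ge0// ltW.
have -> : C * (w s + 1) * q ^+ k = C * q ^+ k * (w s + 1) by ring.
rewrite sub0r normrN ger0_norm; last by apply: (mulr_ge0 Cq); lra.
move=> hk.
have [d' d'0 hd'] := (continuous_normP hN (us k) s).1 (cus k s) (e / 4) (divr_gt0 e0 (ltr0Sn _ _)).
exists (Num.min d d') => [|r]; first by rewrite lt_min d0.
rewrite lt_min => /andP[/hd wr /hd' ur].
apply: le_lt_trans (NB_triangle hN (us k r) _ _) _.
have := NB_triangle hN (us k s) (us k r) (u s).
have := hu k r; have := hu k s; rewrite (NBC hN (u s)).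
have : C * q ^+ k * w r <= C * q ^+ k * (w s + 1) by apply: ler_wpM2l => //; lra.
have : C * q ^+ k * w s <= C * q ^+ k * (w s + 1) by apply: ler_wpM2l => //; lra.
lra.
Qed.

Lemma continuous_expR_dist (a c : R) : continuous (fun s : R => expR (a * `|s - c|)).
Proof.
move=> s; apply: continuous_comp; last exact: continuous_expR.
apply: cvgMr; apply: (@cvg_norm _ R^o).
by apply: cvgB; [exact: cvg_id|exact: cvg_cst].
Qed.

(** Picard iteration with the weight exp (2 L |s - tau|), for which the integral operator contracts
    by 1/2 on the whole line at once. The comparison principle replaces norm estimates of
    vector-valued integrals, and [B] makes the first step finite. *)
Lemma ode_global (F : R -> 'cV[R]_n -> 'cV[R]_n) (L B tau : R) (xi : 'cV[R]_n) :
  0 < L -> (forall x : R -> 'cV[R]_n, continuous x -> continuous (fun s => F s (x s))) ->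
  (forall s x y, N (F s x - F s y) <= L * N (x - y)) ->
  (forall s, N (F s xi) <= B) ->
  exists u : R -> 'cV[R]_n, u tau = xi /\ forall s, is_derive s (1 : R) u (F s (u s)).
Proof.
move=> L0 cF lF bF.
(* [I] is a primitive operator; on discontinuous functions it takes an arbitrary value. *)
have /choice[I hI] (g : R -> 'cV[R]_n) : exists G : R -> 'cV[R]_n,
    continuous g -> forall s, is_derive s (1 : R) G (g s).
  have [cg|ncg] := pselect (continuous g); last by exists g.
  by have [G hG] := primitive_mx cg; exists G.
pose Op u s := xi + (I (fun s => F s (u s)) s - I (fun s => F s (u s)) tau).
have L20 : 0 < 2 * L by rewrite mulr_gt0.
have dOp u s : continuous u -> is_derive s (1 : R) (Op u) (F s (u s)).
  move=> cu; apply: is_derive_addl; apply: is_derive_subr.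
  by apply: hI; exact: cF.
have Otau u : Op u tau = xi by rewrite /Op subrr addr0.
have cOp u : continuous u -> continuous (Op u).
  by move=> cu; apply: (is_derive_continuous (u' := fun s => F s (u s))) => s; exact: dOp.
have B0 : 0 <= B by apply: le_trans (bF 0); exact: N_ge0.
have w0 (s : R) : 0 <= expR (2 * L * `|s - tau|) by exact: expR_ge0.
have C00 : 0 <= B / (2 * L) by rewrite divr_ge0// ltW.
have q01 : 0 < (2^-1 : R) < 1 by rewrite invr_gt0 ltr0n invf_lt1// ltr1n.
have cstc : continuous (cst xi : R -> 'cV[R]_n) by move=> s; exact: cst_continuous.
have Wd (c h : R) : is_derive h (1 : R) (fun h => c * expR (2 * L * h)) (c * (2 * L * expR (2 * L * h))).
  by apply: is_derive_scalel; exact: is_derive_expM.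
have [| | |u cu hu] := @weighted_fixpoint R n N hN R (fun s => expR (2 * L * `|s - tau|))
    (fun u => continuous u) Op 2^-1 (B / (2 * L)) (cst xi) q01 w0 C00 cOp _ _ cstc _.
- move=> u v C C0 cu cv uv s.
  have := @comparison_dist R n N hN (fun s => Op u s - Op v s) (fun s => F s (u s) - F s (v s))
    (fun=> 0) (fun s => L * (C * expR (2 * L * `|s - tau|)))
    (fun h => 2^-1 * C * expR (2 * L * h)) (fun h => 2^-1 * C * (2 * L * expR (2 * L * h)))
    0 tau s.
  apply.
  + by move=> r; apply: continuousB; exact: cOp.
  + by move=> r _; apply: is_derive_funB; exact: dOp.
  + move=> r _; rewrite mul0r add0r; apply: le_trans (lF _ _ _) _.
    by rewrite ler_pM2l.
  + by [].
  + move=> r _; rewrite mul0r add0r le_eqVlt; apply/orP; left; apply/eqP.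
    by field.
  + rewrite !Otau subrr (N0 hN) mulr0 expR0 mulr1 mulr_ge0// invr_ge0//.
- move=> us u C C0 cus hu; apply: weighted_limit_continuous C0 q01 cus hu => //.
  exact: continuous_expR_dist.
- move=> s.
  have := @comparison_dist R n N hN (fun s => Op (cst xi) s - xi) (fun s => F s xi)
    (fun=> 0) (fun s => B)
    (fun h => B / (2 * L) * expR (2 * L * h)) (fun h => B / (2 * L) * (2 * L * expR (2 * L * h)))
    0 tau s.
  apply.
  + by move=> r; apply: continuousB; [exact: cOp|exact: cst_continuous].
  + by move=> r _; apply: is_derive_subr; exact: (dOp (cst xi)).
  + by move=> r _; rewrite mul0r add0r.
  + by [].
  + move=> r _; rewrite mul0r add0r.
    have -> : B / (2 * L) * (2 * L * expR (2 * L * `|r - tau|)) = B * expR (2 * L * `|r - tau|).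
      by field; rewrite gt_eqF.
    by rewrite ler_peMr// -[leLHS]expR0 ler_expR (mulr_ge0 (ltW L20)).
  + by rewrite !Otau subrr (N0 hN) mulr0 expR0 mulr1.
have Ou : Op u = u by apply/funext.
exists u; split; first by rewrite -Ou Otau.
by move=> s; rewrite -{1}Ou; exact: dOp.
Qed.

End GlobalOde.

(** * The grid and solutions with piecewise constant argument *)

(** Dependent choice along the integers in both directions from j; it continues a solution from one
    cell to its two neighbours. *)
Lemma two_sided_choice (X : Type) (P : int -> X -> Prop) (Q : int -> X -> X -> Prop)
    (j : int) (x0 : X) : P j x0 ->
  (forall i x, P i x -> exists2 y, P (i + 1) y & Q i x y) ->
  (forall i y, P (i + 1) y -> exists2 x, P i x & Q i x y) ->
  exists f : int -> X, f j = x0 /\ forall i, P i (f i) /\ Q i (f i) (f (i + 1)).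
Proof.
move=> Px0 Pf Pb.
have /choice[F hF] (ix : int * X) : exists y, P ix.1 ix.2 -> P (ix.1 + 1) y /\ Q ix.1 ix.2 y.
  have [Px|nPx] := pselect (P ix.1 ix.2); last by exists x0.
  by have [y Py Qy] := Pf _ _ Px; exists y.
have /choice[B hB] (iy : int * X) : exists x, P (iy.1 + 1) iy.2 -> P iy.1 x /\ Q iy.1 x iy.2.
  have [Px|nPx] := pselect (P (iy.1 + 1) iy.2); last by exists x0.
  by have [y Py Qy] := Pb _ _ Px; exists y.
pose fw := fix fw (m : nat) := if m is m'.+1 then F (j + m'%:Z, fw m') else x0.
pose bw := fix bw (m : nat) := if m is m'.+1 then B (j - m'.+1%:Z, bw m') else x0.
have shift1 m : j + m%:Z + 1 = j + m.+1%:Z by lia.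
have Pfw m : P (j + m%:Z) (fw m).
  elim: m => [|m IH]; first by rewrite addr0.
  by have := (hF (j + m%:Z, fw m) IH).1; rewrite /= shift1.
have shift m : j - m.+1%:Z + 1 = j - m%:Z by lia.
have Pbw m : P (j - m%:Z) (bw m).
  elim: m => [|m IH]; first by rewrite subr0.
  by apply: (hB (j - m.+1%:Z, bw m) _).1; rewrite /= shift.
(* [Negz m] stands for - (m + 1), hence the index m.+1 of [bw]. *)
pose f i := match i - j with Posz m => fw m | Negz m => bw m.+1 end.
have fP m : f (j + m%:Z) = fw m by rewrite /f addrC addKr.
have fN m : f (j - m%:Z) = bw m.
  rewrite /f addrC addKr; case: m => [|m] //.
have cases i : (exists m, i = j + m%:Z) \/ (exists m, i = j - m.+1%:Z).
  case E : (i - j) => [m|m]; [left; exists m|right; exists m]; lia.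
exists f; split; first by have := fP 0%N; rewrite addr0.
move=> i; have [[m ->]|[m ->]] := cases i.
  rewrite fP; split; first exact: Pfw.
  by rewrite shift1 fP; exact: (hF (j + m%:Z, fw m) (Pfw m)).2.
rewrite fN; split; first exact: Pbw.
rewrite shift fN; apply: (hB (j - m.+1%:Z, bw m) _).2.
by rewrite /= shift.
Qed.

Section Grid.
Variables (R : realType) (t zeta : int -> R) (theta : R) (gamma : R -> R).
Hypothesis hg : is_pca t zeta theta gamma.

Lemma grid_le (i : int) (m : nat) : t i <= t (i + m%:Z).
Proof.
elim: m => [|m IH]; first by rewrite addr0.
have -> : i + m.+1%:Z = i + m%:Z + 1 by lia.
exact: le_trans IH (ltW (pca_lt hg _)).
Qed.

Lemma grid_mono (i j : int) : i <= j -> t i <= t j.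
Proof. by move=> ij; have := grid_le i `|j - i|%N; have -> : i + `|j - i|%N%:Z = j by lia. Qed.

Lemma grid_cell (s : R) : exists i, t i <= s < t (i + 1).
Proof.
have [k hk] : exists k : nat, s < t k%:Z.
  have /cvgryPgt/(_ s)[k _ /(_ k (leqnn k)) h] := pca_pinfty hg; by exists k.
have [l hl] : exists l : nat, t (- l%:Z) <= s.
  have /cvgrNyPlt/(_ s)[l _ /(_ l (leqnn l)) h] := pca_ninfty hg; by exists l; exact: ltW.
have ex : exists m : nat, s < t (- l%:Z + m%:Z).
  by exists (l + k)%N; have -> : - l%:Z + (l + k)%N%:Z = k%:Z by lia.
case: (ex_minnP ex) => -[|m] hm min; first by move: hm; rewrite addr0 ltNge hl.
exists (- l%:Z + m%:Z); rewrite leNgt; apply/andP; split.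
  by apply/negP => /min; rewrite ltnn.
by have -> : - l%:Z + m%:Z + 1 = - l%:Z + m.+1%:Z by lia.
Qed.

Lemma grid_cell_uniq (i j : int) (s : R) :
  t i <= s < t (i + 1) -> t j <= s < t (j + 1) -> i = j.
Proof.
move=> /andP[is_ si] /andP[js sj]; apply/eqP; rewrite eq_le; apply/andP; split.
  rewrite leNgt; apply/negP => ji; have : t (j + 1) <= t i by apply: grid_mono; lia.
  lra.
rewrite leNgt; apply/negP => ij; have : t (i + 1) <= t j by apply: grid_mono; lia.
lra.
Qed.

(** Induction on the number of grid points between r and s, used to turn estimates inside one cell
    into global ones. *)
Lemma grid_chain (Q : R -> R -> Prop) :
  (forall i r s, t i <= r -> r <= s -> s <= t (i + 1) -> Q r s) ->
  (forall r x s, r <= x -> x <= s -> Q r x -> Q x s -> Q r s) ->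
  forall r s, r <= s -> Q r s.
Proof.
move=> loc tr.
have main (m : nat) i r s : t i <= r -> r <= t (i + 1) -> t (i + m%:Z) <= s ->
    s <= t (i + m%:Z + 1) -> r <= s -> Q r s.
  elim: m i r s => [|m IH] i r s; first by rewrite addr0 => *; exact: (loc i).
  move=> ir ri si1 si2 rs.
  have sE : i + m.+1%:Z = i + 1 + m%:Z by lia.
  have le1 := grid_le (i + 1) m.
  rewrite sE in si1 si2.
  apply: (tr _ (t (i + 1))) => //; first by apply: le_trans si1.
    exact: (loc i).
  by apply: (IH (i + 1)) => //; [exact: ltW (pca_lt hg _)|apply: le_trans si1].
move=> r s rs; have [i /andP[ir ri]] := grid_cell r; have [j /andP[js sj]] := grid_cell s.
have ij : i <= j.
  rewrite leNgt; apply/negP => ji; have : t (j + 1) <= t i by apply: grid_mono; lia.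
  lra.
have jE : j = i + `|j - i|%N%:Z by lia.
by rewrite jE in js sj; apply: (main _ i r s ir (ltW ri) js (ltW sj)).
Qed.

End Grid.

Section Glue.
Variables (R : realType) (n : nat) (t zeta : int -> R) (theta : R) (gamma : R -> R).
Variables (N : 'cV[R]_n -> R) (hN : is_norm N).
Hypothesis hg : is_pca t zeta theta gamma.

Lemma glue_cells (us : int -> R -> 'cV[R]_n) :
  (forall i, continuous (us i)) ->
  (forall i, us i (t (i + 1)) = us (i + 1) (t (i + 1))) ->
  exists u : R -> 'cV[R]_n, continuous u /\
    forall i s, t i <= s <= t (i + 1) -> u s = us i s.
Proof.
move=> cus match_us.
have /choice[c hc] := grid_cell hg.
pose u s := us (c s) s.
have uE i s : t i <= s <= t (i + 1) -> u s = us i s.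
  move=> /andP[is_]; rewrite le_eqVlt => /predU1P[->|si]; rewrite /u.
    have -> : c (t (i + 1)) = i + 1; last by rewrite match_us.
    apply: (grid_cell_uniq hg (hc _)); rewrite lexx; exact: (pca_lt hg).
  by have -> : c s = i by apply: (grid_cell_uniq hg (hc s)); rewrite is_.
exists u; split=> // s; apply/(continuous_normP hN) => e e0.
have [i /andP[is_ si]] := grid_cell hg s.
have [d d0 hd] := (continuous_normP hN (us i) s).1 (cus i s) e e0.
move: is_; rewrite le_eqVlt => /predU1P[tis|is_]; last first.
  exists (Num.min d (Num.min (s - t i) (t (i + 1) - s))).
    by rewrite !lt_min d0 !subr_gt0 is_ si.
  move=> r; rewrite !lt_min => /and3P[/hd ? ].
  by rewrite !ltr_norml => h1 h2; rewrite !(uE i)//; lra.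
(* At a grid point the piece of the preceding cell controls the left-hand side, and the matching
   condition makes the two values agree. *)
have [d' d'0 hd'] := (continuous_normP hN (us (i - 1)) s).1 (cus _ s) e e0.
have lt1 := pca_lt hg (i - 1); rewrite subrK in lt1.
exists (Num.min (Num.min d d') (Num.min (t i - t (i - 1)) (t (i + 1) - s))).
  by rewrite !lt_min d0 d'0 !subr_gt0 lt1 si.
move=> r; rewrite !lt_min => /andP[/andP[h1 h2]].
rewrite !ltr_norml => /andP[h3 h4].
case: (leP (t i) r) => tr.
  by rewrite !(uE i); [exact: hd| |]; lra.
by rewrite !(uE (i - 1)); [exact: hd'| |]; rewrite subrK; lra.
Qed.

Lemma is_derive_local (u v : R -> 'cV[R]_n) (a b s : R) (l : 'cV[R]_n) :
  a < s < b -> (forall r, a < r < b -> u r = v r) ->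
  is_derive s (1 : R) v l -> is_derive s (1 : R) u l.
Proof.
move=> asb uv; apply: near_eq_is_derive.
apply/nbhs_ballP; exists (Num.min (s - a) (b - s)) => [|r] /=.
  by rewrite lt_min !subr_gt0; move: asb => /andP[-> ->].
rewrite -ball_normE /ball_ /= lt_min !ltr_norml => h; apply/esym/uv; lra.
Qed.

End Glue.

(** * Existence and growth of solutions with piecewise constant argument *)

Section Depca.
Variables (R : realType) (n : nat) (N : 'cV[R]_n -> R) (hN : is_norm N).
Variables (t zeta : int -> R) (theta : R) (gamma : R -> R).
Hypothesis hg : is_pca t zeta theta gamma.

(** The working form of [is_solution]: [gamma] is replaced by its value on the cell and the
    one-sided derivatives are dropped. [is_solutionP] recovers them from the continuity of the
    right-hand side. *)
Definition cell_solution (G : R -> 'cV[R]_n -> 'cV[R]_n -> 'cV[R]_n)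
    (u : R -> 'cV[R]_n) : Prop :=
  continuous u /\ forall i s, t i < s < t (i + 1) ->
    is_derive s (1 : R) u (G s (u s) (u (zeta i))).

(** A mean value inequality: close to a, the function u s - u a - (s - a) g a has a derivative g s -
    g a of norm below e / 2. *)
Lemma right_derivative (u g : R -> 'cV[R]_n) (a c : R) : a < c ->
  continuous u -> continuous g ->
  (forall s, a < s < c -> is_derive s (1 : R) u (g s)) ->
  h^-1 *: (u (a + h) - u a) @[h --> (0 : R)^'+] --> g a.
Proof.
move=> ac cu cg du; apply/(N_cvgP hN) => e e0.
have [d d0 hd] := (continuous_normP hN g a).1 (cg a) (e / 2) (divr_gt0 e0 (ltr0Sn _ _)).
apply/nbhs_ballP; exists (Num.min d (c - a)) => [|h] /=.
  by rewrite lt_min d0 subr_gt0.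
rewrite -ball_normE /ball_ /= sub0r normrN lt_min => /andP[hd' hca] h0.
rewrite gtr0_norm// in hd' hca.
have -> : h^-1 *: (u (a + h) - u a) - g a = h^-1 *: (u (a + h) - u a - h *: g a).
  by rewrite [in RHS]scalerBr [h^-1 *: (h *: _)]scalerA mulVf ?gt_eqF// scale1r.
rewrite (NZ hN) gtr0_norm ?invr_gt0// mulrC ltr_pdivrMr//.
have dlin (s : R) : is_derive s (1 : R) (fun s => (s - a) *: g a) (g a).
  apply/is_deriveP => e' e'0; exists 1 => // x _.
  have -> : (x + s - a) *: g a - (s - a) *: g a - x *: g a = 0 by mx_ring.
  by rewrite normr0 mulr_ge0// ltW.
have ahc s : a < s < a + h -> a < s < c by lra.
have ahd s : a < s < a + h -> `|s - a| < d by rewrite ltr_norml; lra.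
have := @comparison_right R n N hN (fun s => u s - u a - (s - a) *: g a)
  (fun s => g s - g a) (fun=> 0) (fun=> e / 2) (fun s => (e / 2) * (s - a)) (fun=> e / 2) 0
  a (a + h).
move=> /(_ _ _ _ _ _ _ _ (a + h)).
have -> : a + h - a = h by ring.
move=> H; apply: le_lt_trans (H _ _ _ _ _ _ _ _) _.
- move=> s; apply: cvgB; last exact: (is_derive_continuous dlin).
  by apply: cvgB; [exact: cu|exact: cvg_cst].
- move=> s sah; apply: is_derive_funB (dlin s); apply: is_derive_subr; exact/du/ahc.
- by move=> s sah; rewrite mul0r add0r; apply/ltW/hd/ahd.
- by [].
- move=> s; have := @is_derive_scalel R _ (e / 2) s 1 (is_derive_subr a (is_derive_id s (1 : R))).
  by rewrite mulr1.
- by move=> s _; rewrite mul0r add0r.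
- by rewrite !subrr scale0r subrr (N0 hN) mulr0.
- by rewrite lexx ler_wpDr// ltW.
- by rewrite ltr_pM2r// ltr_pdivrMr// ltr_pMr// ltr1n.
Qed.

Lemma left_derivative (u g : R -> 'cV[R]_n) (a c : R) : c < a ->
  continuous u -> continuous g ->
  (forall s, c < s < a -> is_derive s (1 : R) u (g s)) ->
  h^-1 *: (u (a + h) - u a) @[h --> (0 : R)^'-] --> g a.
Proof.
move=> ca cu cg du.
have cr (w : R -> 'cV[R]_n) : continuous w -> continuous (fun s => w (- s)).
  by move=> cw s; apply: continuous_comp; [exact: opp_continuous|exact: cw].
have := @right_derivative (fun s => u (- s)) (fun s => - g (- s)) (- a) (- c).
rewrite ltrN2 => /(_ ca (cr u cu)) H0.
have {}H0 : h^-1 *: (u (- (- a + h)) - u (- - a)) @[h --> (0 : R)^'+] --> - g (- - a).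
  apply: H0; first by move=> s; apply: cvgN; exact: (cr g cg).
  by move=> s sac; apply: is_derive_reflect; apply: du; lra.
apply/(N_cvgP hN) => e e0.
have /(N_cvgP hN)/(_ e e0)/nbhs_ballP[d /= d0 hd] := H0; apply/nbhs_ballP; exists d => // h.
rewrite -ball_normE /ball_ /= sub0r normrN => hd' h0.
have := hd (- h); rewrite -ball_normE /ball_ /= sub0r opprK => /(_ hd').
rewrite oppr_gt0 => /(_ h0); rewrite opprD !opprK; congr (_ < _).
rewrite -(NN hN); congr N.
by rewrite invrN scaleNr opprD opprK.
Qed.

Lemma is_solutionP (G : R -> 'cV[R]_n -> 'cV[R]_n -> 'cV[R]_n) (u : R -> 'cV[R]_n) :
  (forall (x : R -> 'cV[R]_n) z, continuous x -> continuous (fun s => G s (x s) z)) ->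
  is_solution t gamma G u <-> cell_solution G u.
Proof.
move=> Gc; have gammaE i s : t i < s < t (i + 1) -> gamma s = zeta i.
  by move=> /andP[h1 h2]; apply: (pca_gamma hg); rewrite ltW.
split=> [[cu du _ _]|[cu du]].
  by split=> // i s sti; have := du i s sti; rewrite (gammaE i).
split=> // [i s sti|i|i]; first by rewrite (gammaE i)//; exact: du.
- have lt1 := pca_lt hg (i - 1).
  have := @left_derivative u (fun s => G s (u s) (u (zeta (i - 1)))) (t i) (t (i - 1)).
  rewrite subrK in lt1; move=> /(_ lt1 cu (Gc _ _ cu)) H.
  apply/cvg_ex; eexists; apply: H => s sti.
  by apply: du; rewrite subrK.
- have -> : gamma (t i) = zeta i by apply: (pca_gamma hg); rewrite lexx (pca_lt hg).
  apply: (@right_derivative u (fun s => G s (u s) (u (zeta i))) _ (t (i + 1))) => //.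
  + exact: (pca_lt hg).
  + exact: Gc.
Qed.

Variables (a b : R).
Hypotheses (a0 : 0 < a) (b0 : 0 < b) (theta0 : 0 < theta).
(** The factor with which, by Gronwall's inequality over one cell, the value at [zeta i] acts on
    itself. For v < 1 this feedback can be absorbed. *)
Let v := b * ((expR (a * theta) - 1) / a).
Hypothesis v1 : v < 1.
Let p := a + b * (expR (a * theta) / (1 - v)).

Lemma cell_dist i r s : t i <= r <= t (i + 1) -> t i <= s <= t (i + 1) ->
  `|s - r| <= theta.
Proof. by have := pca_gap hg i; rewrite ler_norml; lra. Qed.

(** Gronwall's inequality from r to [zeta i] bounds N (d (zeta i)) by exp (a theta) N (d r) plus v
    times itself. With the resulting bound inserted as a constant, exp (p h) N (d r) is a majorant,
    because exp (p h) >= 1. *)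
Lemma growth_cell i (d d' : R -> 'cV[R]_n) : continuous d ->
  (forall s, t i < s < t (i + 1) -> is_derive s (1 : R) d (d' s)) ->
  (forall s, t i < s < t (i + 1) -> N (d' s) <= a * N (d s) + b * N (d (zeta i))) ->
  forall r s, t i <= r <= t (i + 1) -> t i <= s <= t (i + 1) ->
  N (d s) <= expR (p * `|s - r|) * N (d r).
Proof.
move=> cd dd Nd' r s rti sti.
have zti := pca_zeta hg i.
have C0 : 0 < expR (a * theta) / (1 - v) by rewrite divr_gt0 ?expR_gt0// subr_gt0.
have hz : N (d (zeta i)) <= expR (a * theta) / (1 - v) * N (d r).
  have := @gronwall R n N hN d d' a (b * N (d (zeta i))) r (zeta i) a0 cd.
  move=> /(_ _ _)/le_trans => H.
  rewrite mulrAC ler_pdivlMr ?subr_gt0//.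
  have := H (expR (a * theta) * N (d r) + N (d (zeta i)) * v).
  have E1 : expR (a * `|zeta i - r|) <= expR (a * theta).
    by rewrite ler_expR ler_pM2l//; exact: (cell_dist rti zti).
  suff h1 : N (d (zeta i)) <= expR (a * theta) * N (d r) + N (d (zeta i)) * v by lra.
  apply: H.
  - by move=> x hx; apply: dd; lra.
  - by move=> x hx; apply: Nd'; lra.
  apply: lerD; first by rewrite ler_wpM2r// N_ge0.
  rewrite mulrAC [leRHS]mulrC ler_wpM2r ?N_ge0//.
  by rewrite /v ler_pM2l// ler_pM2r ?invr_gt0// lerD2r.
apply: (@comparison_dist R n N hN d d' (fun=> a)
  (fun=> b * (expR (a * theta) / (1 - v) * N (d r))) (fun h => expR (p * h) * N (d r))
  (fun h => (p * expR (p * h)) * N (d r)) a r s) => //.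
- by move=> x hx; apply: dd; lra.
- move=> x hx; apply: le_trans (Nd' x _) _; first lra.
  by rewrite lerD2l ler_pM2l.
- move=> h; under eq_fun do rewrite mulrC; rewrite mulrC.
  by apply: is_derive_scalel; exact: is_derive_expM.
- move=> x _; set E := expR (p * _).
  have p0 : 0 < p by rewrite addr_gt0// mulr_gt0.
  have E1 : 1 <= E by rewrite -expR0 ler_expR mulr_ge0// ltW.
  have Nr := N_ge0 hN (d r).
  have -> : p * E * N (d r) = a * (E * N (d r)) + b * (expR (a * theta) / (1 - v)) * N (d r) * E.
    by rewrite /p; ring.
  rewrite lerD2l mulrA ler_peMr// mulr_ge0// mulr_ge0 ?(ltW b0)// ltW//.
- by rewrite mulr0 expR0 mul1r.
Qed.

Lemma growth (d : R -> 'cV[R]_n) (d' : R -> 'cV[R]_n) : continuous d ->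
  (forall i s, t i < s < t (i + 1) -> is_derive s (1 : R) d (d' s)) ->
  (forall i s, t i < s < t (i + 1) -> N (d' s) <= a * N (d s) + b * N (d (zeta i))) ->
  forall r s, N (d s) <= expR (p * `|s - r|) * N (d r).
Proof.
move=> cd dd Nd'.
(* Both time directions are propagated together, since [grid_chain] only treats r <= s. *)
have H := @grid_chain R t zeta theta gamma hg (fun r s =>
  N (d s) <= expR (p * (s - r)) * N (d r) /\ N (d r) <= expR (p * (s - r)) * N (d s)).
have {}H : forall r s, r <= s ->
  N (d s) <= expR (p * (s - r)) * N (d r) /\ N (d r) <= expR (p * (s - r)) * N (d s).
  apply: H.
    move=> i r s ir rs si.
    have g1 := @growth_cell i d d' cd (dd i) (Nd' i) r s ltac:(lra) ltac:(lra).
    have g2 := @growth_cell i d d' cd (dd i) (Nd' i) s r ltac:(lra) ltac:(lra).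
    by rewrite distrC in g2; rewrite ger0_norm ?subr_ge0// in g1 g2.
  move=> r x s rx xs [h1 h2] [h3 h4].
  have E : expR (p * (s - r)) = expR (p * (s - x)) * expR (p * (x - r)).
    by rewrite -expRD; congr expR; ring.
  split; rewrite E.
    by apply: le_trans h3 _; rewrite -mulrA ler_wpM2l// expR_ge0.
  by apply: le_trans h2 _; rewrite -mulrA mulrCA ler_wpM2l// expR_ge0.
move=> r s; have [rs|sr] := leP r s.
  by rewrite ger0_norm ?subr_ge0//; exact: (H r s rs).1.
by rewrite ltr0_norm ?subr_lt0// opprB; exact: (H s r (ltW sr)).2.
Qed.

Variables (G : R -> 'cV[R]_n -> 'cV[R]_n -> 'cV[R]_n) (m : R).
Hypothesis Gc : forall (x : R -> 'cV[R]_n) z, continuous x ->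
  continuous (fun s => G s (x s) z).
Hypothesis Gl : forall s x x' z z',
  N (G s x z - G s x' z') <= a * N (x - x') + b * N (z - z').
Hypothesis Gm : forall s, N (G s 0 0) <= m.

(** The equation involves the value at [zeta i], which may lie on either side of tau. Freezing it as
    z gives an ordinary equation with solution U z, and z |-> U z (zeta i) contracts by v. The fixed
    vector is found as a function on [unit], to fit [weighted_fixpoint]. *)
Lemma cell_solve i tau (xi : 'cV[R]_n) : t i <= tau <= t (i + 1) ->
  exists u : R -> 'cV[R]_n, u tau = xi /\
    forall s, is_derive s (1 : R) u (G s (u s) (u (zeta i))).
Proof.
move=> tti.
have /choice[U hU] (z : 'cV[R]_n) : exists u : R -> 'cV[R]_n, u tau = xi /\
    forall s, is_derive s (1 : R) u (G s (u s) z).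
  apply: (@ode_global R n N hN (fun s x => G s x z) a (m + (a * N xi + b * N z)) tau xi a0).
  - by move=> x cx; exact: Gc.
  - by move=> s x y; have := Gl s x y z z; rewrite subrr (N0 hN) mulr0 addr0.
  - move=> s; have := NB_triangle hN (G s 0 0) (G s xi z) 0.
    by rewrite !subr0; have := Gl s xi 0 z 0; rewrite !subr0; have := Gm s; lra.
have cU z : continuous (U z).
  exact: (is_derive_continuous (u' := fun s => G s (U z s) z) (hU z).2).
have v0 : 0 < v.
  by rewrite mulr_gt0// divr_gt0// subr_gt0 -expR0 ltr_expR mulr_gt0.
have zti := pca_zeta hg i.
have UU z z' : N (U z (zeta i) - U z' (zeta i)) <= v * N (z - z').
  have := @gronwall R n N hN (fun s => U z s - U z' s)
    (fun s => G s (U z s) z - G s (U z' s) z') a (b * N (z - z')) tau (zeta i) a0.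
  rewrite !(hU _).1 subrr (N0 hN) mulr0 add0r => H; apply: le_trans (H _ _ _) _.
  - by move=> s; apply: continuousB; exact: cU.
  - by move=> s _; apply: is_derive_funB; exact: (hU _).2.
  - by move=> s _; exact: Gl.
  rewrite mulrAC ler_wpM2r ?N_ge0// ler_pM2l// ler_pM2r ?invr_gt0// lerD2r.
  by rewrite ler_expR ler_pM2l//; exact: (cell_dist tti zti).
have [|||||||z _ hz] := @weighted_fixpoint R n N hN unit (fun=> 1) setT
  (fun z _ => U (z tt) (zeta i)) v (N (U 0 (zeta i))) (fun=> 0) _ _ (N_ge0 hN _).
- by rewrite v0.
- by [].
- by [].
- move=> z z' C C0 _ _ H s; rewrite mulr1; apply: le_trans (UU _ _) _.
  by rewrite ler_pM2l//; have := H tt; rewrite mulr1.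
- by [].
- by [].
- by move=> s; rewrite subr0 mulr1.
exists (U (z tt)); split; first exact: (hU _).1.
by move=> s; rewrite (hz tt); exact: (hU _).2.
Qed.

Lemma cell_solution_exists tau (xi : 'cV[R]_n) :
  exists u : R -> 'cV[R]_n, cell_solution G u /\ u tau = xi.
Proof.
have [j /andP[jt tj]] := grid_cell hg tau.
have [u0 [u0t du0]] := @cell_solve j tau xi ltac:(lra).
have lti i := ltW (pca_lt hg i).
have [||us [usj H]] := @two_sided_choice _
  (fun i u => forall s, is_derive s (1 : R) u (G s (u s) (u (zeta i))))
  (fun i u u' => u (t (i + 1)) = u' (t (i + 1))) j u0 du0.
- move=> i x _; have [|y [yt dy]] := @cell_solve (i + 1) (t (i + 1)) (x (t (i + 1))).
    by rewrite lexx lti.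
  by exists y.
- move=> i y _; have [|x [xt dx]] := @cell_solve i (t (i + 1)) (y (t (i + 1))).
    by rewrite lexx lti.
  by exists x.
have cus i : continuous (us i).
  exact: (is_derive_continuous (u' := fun s => G s (us i s) (us i (zeta i))) (H i).1).
have [u [cu hu]] := glue_cells hN hg cus (fun i => (H i).2).
exists u; split; last by rewrite (hu j) ?usj ?u0t//; lra.
split=> // i s sti.
rewrite (hu i s) ?(hu i (zeta i)); [|exact: (pca_zeta hg)|lra].
apply: (is_derive_local sti _ ((H i).1 s)) => r rti.
by apply: hu; lra.
Qed.

Lemma cell_solution_growth (x y : R -> 'cV[R]_n) : cell_solution G x -> cell_solution G y ->
  forall r s, N (x s - y s) <= expR (p * `|s - r|) * N (x r - y r).
Proof.
move=> [cx dx] [cy dy].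
have /choice[c hc] := grid_cell hg.
apply: (@growth (fun s => x s - y s)
  (fun s => G s (x s) (x (zeta (c s))) - G s (y s) (y (zeta (c s))))).
- by move=> s; apply: continuousB; [exact: cx|exact: cy].
- move=> i s sti; have -> : c s = i.
    by apply: (grid_cell_uniq hg (hc s)); lra.
  by apply: is_derive_funB; [exact: dx|exact: dy].
- move=> i s sti; have -> : c s = i.
    by apply: (grid_cell_uniq hg (hc s)); lra.
  exact: Gl.
Qed.

End Depca.

(** * Green operator of the linear system *)

Section ScalarBounds.
Variable R : realType.

(** With x = exp c, the derivative x + 1 / x - 2 of the difference equals (x - 1)^2 / x. *)
Lemma sinh_ge (h : R) : 0 <= h -> 2 * h <= expR h - expR (- h).
Proof.
move=> h0.
have df (s : R) : is_derive s (1 : R) (fun s => expR s - expR (- s) - 2 * s) (expR s + expR (- s) - 2).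
  have d1 : is_derive s (1 : R) (fun s => expR s - expR (- s)) (expR s + expR (- s)).
    rewrite -[expR (- s)]opprK; apply: (is_derive_funB (is_derive_expR s)).
    exact: (is_derive_reflect (is_derive_expR (- s))).
  apply: (is_derive_funB d1); have := is_derive_scalel 2 (is_derive_id s (1 : R)).
  by rewrite mulr1.
have [c c0h] := MVT_segment h0 (fun s _ => df s)
  (continuous_subspaceT (is_derive_continuous df)).
rewrite oppr0 subrr mulr0 !subr0 => E; rewrite -subr_ge0 E mulr_ge0//; last by rewrite addr0.
have c1 := expR_gt0 c; have := mulr_ge0 (sqr_ge0 (expR c - 1)) (ltW (expR_gt0 (- c))).
have : expR c * expR (- c) = 1 by rewrite -expRD subrr expR0.
set x := expR c; set y := expR (- c) => xy.
have -> : (x - 1) ^+ 2 * y = x * (x * y) - 2 * (x * y) + y by ring.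
by rewrite xy; lra.
Qed.

(** Centring the difference, that is using [sinh_ge] at u / 2, costs only exp (x / 2); this leaves
    room for the other terms of [green_scalar]. *)
Lemma exp_secant (x u : R) : 0 <= u -> u <= x -> u <= expR (x / 2) * (1 - expR (- u)).
Proof.
move=> u0 ux; have := @sinh_ge (u / 2) ltac:(lra).
have -> : 2 * (u / 2) = u by field.
have -> : expR (u / 2) - expR (- (u / 2)) = expR (u / 2) * (1 - expR (- u)).
  by rewrite mulrBr mulr1 -expRD; have -> : u / 2 + - u = - (u / 2) by field.
move=> h; apply: le_trans h _; rewrite ler_wpM2r//.
  by rewrite subr_ge0 -expR0 ler_expR oppr_le0.
by rewrite ler_expR; lra.
Qed.

(** The source of the factor 2 in [kappa]. The three summands come from the impulses before the
    current cell, those after it, and the forced part inside it; x is the decay rate times theta. *)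
Lemma green_scalar (x p q y1 y2 y3 : R) : 0 <= p -> 0 <= q -> p + q <= x ->
  0 <= y1 -> 0 <= y2 -> y1 + y2 = p + q -> y3 <= p + q ->
  expR (- p) * (expR (x / 2) + y1) + expR (- q) * (expR (x / 2) + y2) + y3 <= 2 * expR x.
Proof.
move=> p0 q0 pqx y10 y20 y12 y3pq.
have P1 : expR (- p) <= 1 by rewrite -[leRHS]expR0 ler_expR oppr_le0.
have Q1 : expR (- q) <= 1 by rewrite -[leRHS]expR0 ler_expR oppr_le0.
have PQ : expR (- p) * expR (- q) = expR (- (p + q)) by rewrite -expRD opprD.
have a1 : 1 <= expR (x / 2) by rewrite -[leLHS]expR0 ler_expR; lra.
have c1 : 1 <= expR (p + q) by rewrite -[leLHS]expR0 ler_expR; lra.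
have aa : expR x = expR (x / 2) * expR (x / 2) by rewrite -expRD; congr expR; field.
have ca : expR (p + q) <= expR (x / 2) * expR (x / 2) by rewrite -aa ler_expR.
have cd : expR (p + q) * expR (- (p + q)) = 1 by rewrite -expRD subrr expR0.
have := @sinh_ge (p + q) ltac:(lra).
have d0 := expR_gt0 (- (p + q)).
rewrite aa; move: PQ P1 Q1 a1 c1 ca cd d0.
set P := expR (- p); set Q := expR (- q); set a := expR (x / 2); set c := expR (p + q).
set d := expR (- (p + q)) => PQ P1 Q1 a1 c1 ca cd d0 hs.
have h1 : P * y1 <= y1 by rewrite ler_piMl.
have h2 : Q * y2 <= y2 by rewrite ler_piMl.
have h3 : a * (P + Q) <= a * (1 + d).
  rewrite ler_wpM2l//; first lra.
  have : 0 <= (1 - P) * (1 - Q) by rewrite mulr_ge0// subr_ge0.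
  by rewrite mulrBr mulr1 mulrBl mul1r PQ; lra.
(* Here y1 + y2 + y3 <= 2 (p + q) <= c - d was used. What remains concerns a >= 1 and 1 <= c <= a^2
   with d = 1 / c, and the difference of the two sides is d times a sum of nonnegative products. *)
suff h4 : a * (1 + d) + c - d <= 2 * (a * a) by lra.
have k1 : 0 <= d * ((c - 1) * (a * a - c)) by rewrite mulr_ge0 ?(ltW d0)// mulr_ge0// subr_ge0.
have k2 : 0 <= d * ((c - 1) * ((a - 1) * a)).
  by rewrite mulr_ge0 ?(ltW d0)// mulr_ge0 ?subr_ge0// mulr_ge0 ?subr_ge0//; lra.
have k4 : 0 <= d * ((a * a - c) * 1) by rewrite mulr_ge0 ?(ltW d0)// mulr1 subr_ge0.
have k5 : 0 <= d * (a - 1) ^+ 2 by rewrite mulr_ge0 ?(ltW d0)// sqr_ge0.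
have E : 2 * (a * a) - (a * (1 + d) + c - d) =
    d * (2 * (a * a) * c - a * c - a - c * c + 1).
  have -> : d * (2 * (a * a) * c - a * c - a - c * c + 1) =
    2 * (a * a) * (c * d) - a * (c * d) - a * d - c * (c * d) + d by ring.
  by rewrite cd; ring.
rewrite -subr_ge0 E.
have -> : d * (2 * (a * a) * c - a * c - a - c * c + 1) =
  d * ((c - 1) * (a * a - c)) + d * ((c - 1) * ((a - 1) * a)) + d * ((a * a - c) * 1)
  + d * (a - 1) ^+ 2.
  ring.
lra.
Qed.

End ScalarBounds.

(** * Exponentially decaying series sampled on interlaced grids *)

Section DecaySeries.
Variables (R : realType) (n : nat) (N : 'cV[R]_n -> R) (hN : is_norm N).

Lemma mulmx_fun_continuous (A : R -> 'M[R]_n) (x : R -> 'cV[R]_n) :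
  continuous A -> continuous x -> continuous (fun s => A s *m x s).
Proof.
move=> cA cx s; apply/(N_cvgP hN) => e e0; have [c c0 hc] := N_mulmx_le hN.
pose h r := c * `|A r - A s| * N (x r) + c * `|A s| * N (x r - x s).
have ch : h r @[r --> s] --> h s.
  have cN (y : R -> 'cV[R]_n) : continuous y -> N (y r) @[r --> s] --> N (y s).
    by move=> cy; apply: (continuous_comp (cy s)); exact: N_continuous.
  apply: cvgD; apply: cvgM.
  - apply: cvgMr; apply: cvg_norm; apply: cvgB; [exact: cA|exact: cvg_cst].
  - exact: cN.
  - exact: cvg_cst.
  - apply: (cN (fun r => x r - x s)) => r.
    by apply: cvgB; [exact: cx|exact: cvg_cst].
have h0 : h s = 0 by rewrite /h !subrr normr0 mulr0 mul0r (N0 hN) mulr0 addr0.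
rewrite h0 in ch; have /cvgrPdist_lt/(_ e e0) := ch.
apply: filterS => r; rewrite sub0r normrN => /(le_lt_trans (ler_norm _)).
apply: le_lt_trans.
have -> : A r *m x r - A s *m x s = (A r - A s) *m x r + A s *m (x r - x s).
  by rewrite mulmxBl mulmxBr addrA subrK.
by apply: le_trans (ND hN _ _) _; rewrite lerD.
Qed.

Lemma cvg_mulmxl (B : 'M[R]_n) (x : nat -> 'cV[R]_n) (l : 'cV[R]_n) :
  x @ \oo --> l -> (fun k => B *m x k) @ \oo --> B *m l.
Proof.
move=> xl; apply/(N_cvgP hN) => e e0.
have B0 := opnorm_ge0 hN B.
have B1 : 0 < opnorm N B + 1 by lra.
have /(N_cvgP hN)/(_ _ (divr_gt0 e0 B1)) := xl.
apply: filterS => k; rewrite ltr_pdivlMr// => h; rewrite -mulmxBr.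
apply: le_lt_trans (opnorm_le hN _ _) _; apply: le_lt_trans h.
by rewrite mulrC ler_wpM2l ?(N_ge0 hN)// lerDl.
Qed.

Lemma cV_cvg_unique (x : nat -> 'cV[R]_n) (l l' : 'cV[R]_n) :
  x @ \oo --> l -> x @ \oo --> l' -> l = l'.
Proof. by move=> xl xl'; apply: (cvg_unique _ xl xl'); exact: norm_hausdorff. Qed.

Variables (T U : nat -> R) (theta al : R).
Hypotheses (T0 : T 0%N = 0) (U0 : U 0%N <= 0) (al0 : 0 < al).
Hypotheses (UT : forall k, U k <= T k <= U k.+1).
Hypotheses (TU : forall k, T k - U k <= theta) (UT' : forall k, U k.+1 - T k <= theta).

(* A discrete form of the integral of al * expR (- al * x) over the half line, with the
   points T k at which the exponential is sampled interlaced with the U k. The factor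
   expR (al * theta / 2) absorbs the discretisation error, and the right-hand side
   telescopes; the term - al * U 0 accounts for the part of the first interval left of 0. *)
Lemma decay_term k :
  al * expR (- al * T k) * (U k.+1 - U k) <=
  (if k is 0%N then expR (al * theta / 2) - al * U 0%N
   else expR (al * theta / 2) * expR (- al * U k))
  - expR (al * theta / 2) * expR (- al * U k.+1).
Proof.
have /andP[UTk TUk] := UT k; have TUk' := TU k; have UTk' := UT' k.
set E := expR (al * theta / 2).
have th0 : 0 <= al * theta by rewrite mulr_ge0 ?(ltW al0)//; lra.
have E1 : 1 <= E by rewrite /E -[leLHS]expR0 ler_expR; lra.
have e1 : al * expR (- al * T k) * (U k.+1 - T k) <=
    E * (expR (- al * T k) - expR (- al * U k.+1)).
  have h1 : 0 <= al * (U k.+1 - T k) by rewrite mulr_ge0 ?(ltW al0)// subr_ge0.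
  have h2 : al * (U k.+1 - T k) <= al * theta by rewrite ler_pM2l.
  have := exp_secant h1 h2; rewrite -/E => h3.
  have -> : expR (- al * U k.+1) = expR (- al * T k) * expR (- (al * (U k.+1 - T k))).
    by rewrite -expRD; congr expR; ring.
  have := ler_wpM2l (expR_ge0 (- al * T k)) h3.
  by set X := expR _; set Y := expR _; lra.
have -> : al * expR (- al * T k) * (U k.+1 - U k) =
  al * expR (- al * T k) * (U k.+1 - T k) + al * expR (- al * T k) * (T k - U k) by ring.
case: k => [|k] in UTk TUk TUk' UTk' e1 *.
  rewrite T0 mulr0 expR0 !mulr1 in e1 *; lra.
have e2 : al * expR (- al * T k.+1) * (T k.+1 - U k.+1) <=
    E * (expR (- al * U k.+1) - expR (- al * T k.+1)).
  have h1 : 0 <= al * (T k.+1 - U k.+1) by rewrite mulr_ge0 ?(ltW al0)// subr_ge0.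
  have := expR_ge1Dx (al * (T k.+1 - U k.+1)) => h3.
  have e3 : expR (- al * U k.+1) = expR (- al * T k.+1) * expR (al * (T k.+1 - U k.+1)).
    by rewrite -expRD; congr expR; ring.
  have h4 : expR (- al * T k.+1) <= expR (- al * U k.+1).
    by rewrite ler_expR !mulNr lerN2 ler_pM2l.
  apply: (@le_trans _ _ (1 * (expR (- al * U k.+1) - expR (- al * T k.+1)))).
    rewrite mul1r e3; have := ler_wpM2l (expR_ge0 (- al * T k.+1)) h3.
    by set X := expR _; set Y := expR _; lra.
  by rewrite ler_wpM2r// subr_ge0.
by move: e1 e2; set X := expR _; set Y := expR _; set W := expR _; lra.
Qed.

(** The right-hand sides of [decay_term] telescope, so one potential [b] gives the convergence and,
    at index 0, the bound on the sum. *)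
Lemma decay_series (e : nat -> 'cV[R]_n) (c : R) : 0 <= c ->
  (forall k, N (e k) <= c * expR (- al * T k) * (U k.+1 - U k)) ->
  exists l : 'cV[R]_n, ((fun m => \sum_(k < m) e k) @ \oo --> l) /\
    N l <= c / al * (expR (al * theta / 2) - al * U 0%N).
Proof.
move=> c0 he.
pose b k : R := c / al * (if k is 0%N then expR (al * theta / 2) - al * U 0%N
   else expR (al * theta / 2) * expR (- al * U k)).
have ca0 : 0 <= c / al by rewrite divr_ge0// ltW.
have [||l [xl hl]] := @N_telescope_cvg R n N hN (fun m => \sum_(k < m) e k) b.
- move=> k; rewrite big_ord_recr /= [_ + e k]addrC addrK; apply: le_trans (he k) _.
  rewrite /b -mulrBr; apply: le_trans (ler_wpM2l ca0 (decay_term k)).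
  by rewrite le_eqVlt; apply/orP; left; apply/eqP; field; rewrite gt_eqF.
- move=> k; apply: (mulr_ge0 ca0); case: k => [|k].
    by rewrite subr_ge0 (le_trans _ (expR_ge0 _))// pmulr_rle0.
  by rewrite mulr_ge0 ?expR_ge0.
exists l; split=> //; have := hl 0%N; rewrite big_ord0 subr0 //.
Qed.

(** The impulses are summed at time 0 but estimated at time s, after transport by B = Z(s, 0). By
    uniqueness of limits the transported series has sum B l. *)
Lemma decay_series_limit (e : nat -> 'cV[R]_n) (B : 'M[R]_n) (c : R) (l : 'cV[R]_n) : 0 <= c ->
  (forall k, N (B *m e k) <= c * expR (- al * T k) * (U k.+1 - U k)) ->
  ((fun m => \sum_(k < m) e k) @ \oo --> l) ->
  N (B *m l) <= c / al * (expR (al * theta / 2) - al * U 0%N).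
Proof.
move=> c0 he /(cvg_mulmxl (B := B)) xl; have [l' [xl' hl']] := decay_series c0 he.
suff -> : B *m l = l' by [].
apply: cV_cvg_unique xl _.
by under eq_fun do rewrite mulmx_sumr.
Qed.

End DecaySeries.

(** * The linear system: transition matrix, local forcing and dichotomy *)

Section Linear.
Variables (R : realType) (n : nat) (N : 'cV[R]_n -> R) (hN : is_norm N).
Variables (t zeta : int -> R) (theta : R) (gamma : R -> R).
Hypothesis hg : is_pca t zeta theta gamma.
Variables (A A0 : R -> 'M[R]_n) (M : R) (Z : R -> R -> 'M[R]_n) (P : 'M[R]_n) (K al : R).
Hypotheses (hA : continuous A) (hA0 : continuous A0) (M0 : 0 < M).
Hypothesis hAM : forall s, opnorm N (A s) <= M.
Hypothesis theta0 : 0 < theta.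
Hypothesis hZ : is_transition t gamma A A0 Z.
Hypothesis hdich : exp_dichotomy N Z P K al.
(** A primitive of the operator norm of [A]: exp (As s - As r) bounds the growth of solutions of y'
    = A y from r to s. *)
Variable As : R -> R.
Hypothesis hAs : forall s, is_derive s (1 : R) As (opnorm N (A s)).

Lemma lin_rhs_continuous (x : R -> 'cV[R]_n) z : continuous x ->
  continuous (fun s => lin_rhs A A0 s (x s) z).
Proof.
move=> cx s; apply: cvgD; first exact: (mulmx_fun_continuous hN hA cx).
by apply: (mulmx_fun_continuous hN hA0 (x := fun=> z)) => r; exact: cvg_cst.
Qed.

Lemma transition_solution tau (xi : 'cV[R]_n) :
  cell_solution t zeta (lin_rhs A A0) (fun s => Z s tau *m xi).
Proof.
have [[hsol _] _] := hZ tau xi.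
exact: (is_solutionP hN hg (fun s => Z s tau *m xi) lin_rhs_continuous).1.
Qed.

Lemma transition_id tau (xi : 'cV[R]_n) : Z tau tau *m xi = xi.
Proof. by have [[_ ->] _] := hZ tau xi. Qed.

Lemma transition_uniq (y : R -> 'cV[R]_n) tau :
  cell_solution t zeta (lin_rhs A A0) y -> y = (fun s => Z s tau *m y tau).
Proof.
move=> sy; have [_ u] := hZ tau (y tau); symmetry; apply: u; split=> //.
exact: (is_solutionP hN hg y lin_rhs_continuous).2.
Qed.

Lemma transition_cocycle s r tau (xi : 'cV[R]_n) : Z s r *m (Z r tau *m xi) = Z s tau *m xi.
Proof. by have /(congr1 (@^~ s)) /= := transition_uniq r (transition_solution tau xi). Qed.

Lemma opnorm_primitive_mono r s : r <= s -> 0 <= As s - As r <= M * (s - r).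
Proof.
move=> rs; have [c _ ->] := MVT_segment rs (fun s _ => hAs s)
  (continuous_subspaceT (is_derive_continuous hAs)).
rewrite mulr_ge0 ?(opnorm_ge0 hN) ?subr_ge0//=.
by rewrite ler_wpM2r ?subr_ge0.
Qed.

(** The integrals in [rho_plus] and [rho_minus] add up to the one over the whole cell. Their
    exponentials are bounded by exp (M theta), so the supremum in [rho] is an upper bound. *)
Lemma exp_opnorm_le_rho j r s : t j <= r -> r <= s -> s <= t (j + 1) ->
  expR (As s - As r) <= rho N t zeta A.
Proof.
move=> jr rs sj.
have prod k : rho_plus N t zeta A k * rho_minus N t zeta A k = expR (As (t (k + 1)) - As (t k)).
  have zk := pca_zeta hg k.
  rewrite /rho_plus /rho_minus -expRD.
  rewrite !(primitive_Rintegral _ (opnorm_continuous hN hA) hAs); [|lra|lra].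
  by congr expR; ring.
apply: (@le_trans _ _ (expR (As (t (j + 1)) - As (t j)))).
  rewrite ler_expR; have := opnorm_primitive_mono jr; have := opnorm_primitive_mono sj.
  lra.
rewrite -prod /rho; apply: sup_upper_bound; last by exists j.
split; first by exists (rho_plus N t zeta A j * rho_minus N t zeta A j), j.
exists (expR (M * theta)) => _ [k _ <-]; rewrite prod ler_expR.
have := opnorm_primitive_mono (ltW (pca_lt hg k)).
have : M * (t (k + 1) - t k) <= M * theta by rewrite ler_pM2l// (pca_gap hg).
lra.
Qed.

Lemma rho_ge1 : 1 <= rho N t zeta A.
Proof.
have := @exp_opnorm_le_rho 0 (t 0) (t 0); rewrite subrr expR0; apply => //.
exact: ltW (pca_lt hg 0).
Qed.

Lemma forced_exists (c G : R) (g : R -> 'cV[R]_n) : continuous g -> (forall s, N (g s) <= G) ->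
  exists w : R -> 'cV[R]_n, w c = 0 /\ forall s, is_derive s (1 : R) w (A s *m w s + g s).
Proof.
move=> cg gG.
apply: (@ode_global R n N hN (fun s x => A s *m x + g s) M G c 0 M0).
- move=> x cx s; apply: cvgD; last exact: cg.
  exact: (mulmx_fun_continuous hN hA cx).
- move=> s x y; have -> : A s *m x + g s - (A s *m y + g s) = A s *m (x - y).
    by rewrite mulmxBr opprD addrACA subrr addr0.
  apply: le_trans (opnorm_le hN _ _) _; rewrite ler_wpM2r ?(N_ge0 hN)//.
- by move=> s; rewrite mulmx0 add0r.
Qed.

(** The majorant is the exponential of the integral of the norm of [A] between [zeta j] and s, times
    |s - zeta j| G. Being linear in |s - zeta j|, the bound yields impulses proportional to
    differences of successive [zeta]. *)
Lemma forced_bound j (w g : R -> 'cV[R]_n) (G : R) :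
  w (zeta j) = 0 -> (forall s, is_derive s (1 : R) w (A s *m w s + g s)) ->
  (forall s, t j <= s <= t (j + 1) -> N (g s) <= G) ->
  forall s, t j <= s <= t (j + 1) -> N (w s) <= rho N t zeta A * `|s - zeta j| * G.
Proof.
move=> w0 dw gG s sj; have zj := pca_zeta hg j.
have G0 : 0 <= G by apply: le_trans (gG s sj); exact: N_ge0.
have cw : continuous w by exact: (is_derive_continuous dw).
have Nw r : t j <= r <= t (j + 1) -> N (A r *m w r + g r) <= opnorm N (A r) * N (w r) + G.
  by move=> rj; apply: le_trans (ND hN _ _) _; rewrite lerD ?(opnorm_le hN)// gG.
have [zs|sz] := leP (zeta j) s.
  have := @comparison_right R n N hN w (fun s => A s *m w s + g s) (fun s => opnorm N (A s))
    (fun=> G) (fun s => expR (As s - As (zeta j)) * ((s - zeta j) * G))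
    (fun s => opnorm N (A s) * expR (As s - As (zeta j)) * ((s - zeta j) * G)
       + expR (As s - As (zeta j)) * G) M (zeta j) s cw.
  move=> H; apply: (@le_trans _ _ (expR (As s - As (zeta j)) * ((s - zeta j) * G))).
    apply: H.
    - by move=> r hr; apply: Nw; lra.
    - exact: hAM.
    - move=> r; apply: is_derive_funM.
        by apply: is_derive_expR_comp; apply: is_derive_subr; exact: hAs.
      under eq_fun do rewrite mulrC; rewrite -[X in is_derive _ _ _ X]mulr1.
      apply: is_derive_scalel; apply: is_derive_subr; exact: is_derive_id.
    - move=> r hr; rewrite mulrA lerD2l ler_peMl// -[leLHS]expR0 ler_expR.
      have : zeta j <= r by lra.
      by move=> /opnorm_primitive_mono/andP[].
    - by rewrite w0 (N0 hN) !subrr mul0r mulr0.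
    - by rewrite zs lexx.
  rewrite ger0_norm ?subr_ge0// mulrA; apply: ler_wpM2r => //; apply: ler_wpM2r.
    by rewrite subr_ge0.
  by apply: (@exp_opnorm_le_rho j) => //; lra.
have := @comparison_left R n N hN w (fun s => A s *m w s + g s) (fun s => opnorm N (A s))
  (fun=> G) (fun s => expR (As (zeta j) - As s) * ((zeta j - s) * G))
  (fun s => - opnorm N (A s) * expR (As (zeta j) - As s) * ((zeta j - s) * G)
     + expR (As (zeta j) - As s) * (G * -1)) M (zeta j) s cw.
move=> H; apply: (@le_trans _ _ (expR (As (zeta j) - As s) * ((zeta j - s) * G))).
  have nd (f : R -> R) (c r v : R) : is_derive r (1 : R) f v -> is_derive r (1 : R) (fun r => c - f r) (- v).
    move=> df; rewrite -[- v]add0r.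
    exact: (is_derive_funB (f := cst c) (is_derive_cst _ _ _) df).
  apply: H.
  - by move=> r hr; apply: Nw; lra.
  - exact: hAM.
  - move=> r; apply: is_derive_funM.
      by apply: is_derive_expR_comp; apply: nd; exact: hAs.
    under eq_fun do rewrite mulrC.
    apply: is_derive_scalel; apply: nd; exact: is_derive_id.
  - move=> r hr; rewrite mulrN1 mulrN opprD opprK !mulNr opprK mulrA lerD2l ler_peMl//.
    rewrite -[leLHS]expR0 ler_expR.
    have : r <= zeta j by lra.
    by move=> /opnorm_primitive_mono/andP[].
  - by rewrite w0 (N0 hN) !subrr mul0r mulr0.
  - by rewrite lexx ltW.
rewrite ltr0_norm ?subr_lt0// opprB mulrA; apply: ler_wpM2r => //; apply: ler_wpM2r.
  by rewrite subr_ge0 ltW.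
by apply: (@exp_opnorm_le_rho j) => //; lra.
Qed.

Lemma dich_stable r s (x : 'cV[R]_n) : r <= s ->
  N (Z s 0 *m (P *m (Z 0 r *m x))) <= K * expR (- al * (s - r)) * N x.
Proof.
move=> rs; have := dich_bound hdich s r.
rewrite /Defs.Zp rs ger0_norm ?subr_ge0// => h; rewrite !mulmxA.
by apply: le_trans (opnorm_le hN _ _) _; rewrite ler_wpM2r// N_ge0.
Qed.

Lemma dich_unstable r s (x : 'cV[R]_n) : s < r ->
  N (Z s 0 *m ((1%:M - P) *m (Z 0 r *m x))) <= K * expR (- al * (r - s)) * N x.
Proof.
move=> sr; have := dich_bound hdich s r.
rewrite /Defs.Zp (lt_geF sr) ltr0_norm ?subr_lt0// opprB => h; rewrite !mulmxA -(NN hN) -mulNmx.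
by apply: le_trans (opnorm_le hN _ _) _; rewrite ler_wpM2r// N_ge0.
Qed.

(** The stable part of y 0 is transported from time - h and the unstable part from time h. Both are
    at most K B exp (- al h) for every h > 0. *)
Lemma bounded_solution0 (y : R -> 'cV[R]_n) (B : R) :
  cell_solution t zeta (lin_rhs A A0) y -> (forall s, N (y s) <= B) -> forall s, y s = 0.
Proof.
move=> sy yB.
have al0 := dich_alpha hdich; have K1 := dich_K hdich.
have B0 : 0 <= B by apply: le_trans (yB 0); exact: N_ge0.
have zero (v : 'cV[R]_n) : (forall h, 0 < h -> N v <= K * expR (- al * h) * B) -> v = 0.
  move=> hv; apply/(norm_definite hN)/le_anti; rewrite (N_ge0 hN) andbT leNgt.
  apply/negP => v0.
  have KB : 0 <= K * B by rewrite mulr_ge0//; lra.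
  (* Chosen so that N v * (1 + al h), a lower bound of N v * exp (al h), exceeds K B. *)
  pose h := (K * B + 1) / (N v * al).
  have Na : 0 < N v * al by rewrite mulr_gt0.
  have h0 : 0 < h by rewrite divr_gt0//; lra.
  have := hv h h0; rewrite mulrAC mulNr expRN ler_pdivlMr ?expR_gt0// => h1.
  have := ler_wpM2l (ltW v0) (expR_ge1Dx (al * h)).
  have -> : N v * (1 + al * h) = N v + h * (N v * al) by ring.
  rewrite /h divfK ?gt_eqF//; rewrite -/h; lra.
have yE s : Z 0 s *m y s = y 0 by rewrite [in RHS](transition_uniq s sy).
have Py : P *m y 0 = 0.
  apply: zero => h h0; have := @dich_stable (- h) 0 (y (- h)) ltac:(lra).
  rewrite yE transition_id sub0r opprK => /le_trans; apply.
  by rewrite ler_wpM2l// mulr_ge0 ?expR_ge0//; lra.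
have Qy : (1%:M - P) *m y 0 = 0.
  apply: zero => h h0; have := @dich_unstable h 0 (y h) h0.
  rewrite yE transition_id subr0 => /le_trans; apply.
  by rewrite ler_wpM2l// mulr_ge0 ?expR_ge0//; lra.
have y0 : y 0 = 0 by rewrite -[y 0]mul1mx -[1%:M](subrK P) mulmxDl Qy Py addr0.
by move=> s; rewrite (transition_uniq 0 sy) y0 mulmx0.
Qed.

End Linear.

(** * Sums of impulses under the dichotomy *)

Section GreenEstimate.
Variables (R : realType) (n : nat) (N : 'cV[R]_n -> R) (hN : is_norm N).
Variables (t zeta : int -> R) (theta : R) (gamma : R -> R).
Hypothesis hg : is_pca t zeta theta gamma.
Variables (A A0 : R -> 'M[R]_n) (M : R) (Z : R -> R -> 'M[R]_n) (P : 'M[R]_n) (K al : R).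
Hypotheses (hA : continuous A) (hA0 : continuous A0) (M0 : 0 < M).
Hypothesis hAM : forall s, opnorm N (A s) <= M.
Hypothesis hZ : is_transition t gamma A A0 Z.
Hypothesis hdich : exp_dichotomy N Z P K al.
Variable As : R -> R.
Hypothesis hAs : forall s, is_derive s (1 : R) As (opnorm N (A s)).

Local Notation rho_ := (rho N t zeta A).

(* The distances T and U of decay_series, backwards from t j and forwards from t (j + 1). *)
Let Tm j (k : nat) := t j - t (j - k%:Z).
Let Um j (k : nat) := t j - zeta (j - k%:Z).
Let Tp j (k : nat) := t (j + 1 + k%:Z) - t (j + 1).
Let Up j (k : nat) := zeta (j + k%:Z) - t (j + 1).

Lemma backward_grid j :
  [/\ Tm j 0 = 0, Um j 0 <= 0, forall k, Um j k <= Tm j k <= Um j k.+1,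
   forall k, Tm j k - Um j k <= theta & forall k, Um j k.+1 - Tm j k <= theta].
Proof.
rewrite /Tm /Um; split.
- by rewrite subr0 subrr.
- by rewrite subr0; have := pca_zeta hg j; lra.
- move=> k; have := pca_zeta hg (j - k%:Z); have := pca_zeta hg (j - k.+1%:Z).
  have -> : j - k.+1%:Z + 1 = j - k%:Z by lia. lra.
- move=> k; have := pca_zeta hg (j - k%:Z); have := pca_gap hg (j - k%:Z); lra.
- move=> k; have := pca_zeta hg (j - k.+1%:Z); have := pca_gap hg (j - k.+1%:Z).
  have -> : j - k.+1%:Z + 1 = j - k%:Z by lia. lra.
Qed.

Lemma forward_grid j :
  [/\ Tp j 0 = 0, Up j 0 <= 0, forall k, Up j k <= Tp j k <= Up j k.+1,
   forall k, Tp j k - Up j k <= theta & forall k, Up j k.+1 - Tp j k <= theta].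
Proof.
rewrite /Tp /Up; split.
- by rewrite addr0 subrr.
- by rewrite addr0; have := pca_zeta hg j; lra.
- move=> k; have := pca_zeta hg (j + k%:Z); have := pca_zeta hg (j + k.+1%:Z).
  have -> : j + k.+1%:Z = j + 1 + k%:Z by lia.
  have -> : j + k%:Z + 1 = j + 1 + k%:Z by lia. lra.
- move=> k; have := pca_zeta hg (j + k%:Z); have := pca_gap hg (j + k%:Z).
  have -> : j + k%:Z + 1 = j + 1 + k%:Z by lia. lra.
- move=> k; have := pca_zeta hg (j + k.+1%:Z); have := pca_gap hg (j + k.+1%:Z).
  have -> : j + k.+1%:Z = j + 1 + k%:Z by lia. lra.
Qed.

Section Impulses.
Variables (eta : int -> 'cV[R]_n) (D be tau : R).
Hypotheses (D0 : 0 <= D) (be0 : 0 <= be).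
Hypothesis heta : forall i,
  N (eta i) <= rho_ * (zeta i - zeta (i - 1)) * (D * expR (be * `|t i - tau|)).

Let cst_ s := K * rho_ * D * expR (be * `|s - tau|).

Lemma rho_gt0 : 0 < rho_.
Proof. by have := rho_ge1 hN hg hA M0 hAM hAs; lra. Qed.

Lemma cst_ge0 s : 0 <= cst_ s.
Proof.
have K1 := dich_K hdich.
have K0 : 0 <= K by lra.
by rewrite /cst_ !mulr_ge0 ?expR_ge0// ltW// rho_gt0.
Qed.

(** Moving the weight from t i to s costs exp (be h) by the triangle inequality, which lowers the
    decay rate from al to al - be. *)
Lemma impulse_decay (x : 'cV[R]_n) (i : int) (s h : R) :
  `|s - t i| = h -> N x <= K * expR (- al * h) * N (eta i) ->
  N x <= cst_ s * expR (- (al - be) * h) * (zeta i - zeta (i - 1)).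
Proof.
move=> sh /le_trans; apply; have K1 := dich_K hdich.
have K0 : 0 <= K * expR (- al * h) by rewrite mulr_ge0 ?expR_ge0//; lra.
apply: le_trans (ler_wpM2l K0 (heta i)) _.
have zz : 0 <= zeta i - zeta (i - 1).
  by have := pca_zeta hg i; have := pca_zeta hg (i - 1); rewrite subrK; lra.
have -> : K * expR (- al * h) * (rho_ * (zeta i - zeta (i - 1)) * (D * expR (be * `|t i - tau|)))
  = K * rho_ * D * (zeta i - zeta (i - 1)) * (expR (- al * h) * expR (be * `|t i - tau|)) by ring.
have -> : cst_ s * expR (- (al - be) * h) * (zeta i - zeta (i - 1)) =
  K * rho_ * D * (zeta i - zeta (i - 1)) * (expR (- (al - be) * h) * expR (be * `|s - tau|)).
  by rewrite /cst_; ring.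
apply: ler_wpM2l; first by rewrite !mulr_ge0// ?(ltW rho_gt0)//; lra.
rewrite -!expRD ler_expR.
have : be * `|t i - tau| <= be * (h + `|s - tau|).
  by rewrite ler_wpM2l// -sh [`|s - t i|]distrC; have := ler_distD s (t i) tau; lra.
lra.
Qed.

Let e i := Z 0 (t i) *m eta i.

Lemma stable_term j s k : t j <= s ->
  N (Z s 0 *m (P *m e (j - k%:Z))) <=
  cst_ s * expR (- (al - be) * (s - t j)) * expR (- (al - be) * Tm j k) *
    (Um j k.+1 - Um j k).
Proof.
move=> js; have le1 : t (j - k%:Z) <= t j by apply: (grid_mono hg); lia.
have := @impulse_decay (Z s 0 *m (P *m e (j - k%:Z))) (j - k%:Z) s (s - t (j - k%:Z)).
move=> /(_ _ _)/le_trans; apply.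
- by rewrite ger0_norm// subr_ge0 (le_trans le1).
- by apply: (dich_stable hN hdich); exact: le_trans js.
rewrite /Um /Tm.
have -> : j - k%:Z - 1 = j - k.+1%:Z by lia.
have E : expR (- (al - be) * (s - t (j - k%:Z))) =
    expR (- (al - be) * (s - t j)) * expR (- (al - be) * (t j - t (j - k%:Z))).
  by rewrite -expRD; congr expR; ring.
rewrite E le_eqVlt; apply/orP; left; apply/eqP; ring.
Qed.

Lemma unstable_term j s k : s < t (j + 1) ->
  N (Z s 0 *m ((1%:M - P) *m e (j + 1 + k%:Z))) <=
  cst_ s * expR (- (al - be) * (t (j + 1) - s)) * expR (- (al - be) * Tp j k) *
    (Up j k.+1 - Up j k).
Proof.
move=> js; have le1 : t (j + 1) <= t (j + 1 + k%:Z) by apply: (grid_mono hg); lia.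
have := @impulse_decay (Z s 0 *m ((1%:M - P) *m e (j + 1 + k%:Z))) (j + 1 + k%:Z) s
  (t (j + 1 + k%:Z) - s).
move=> /(_ _ _)/le_trans; apply.
- by rewrite ltr0_norm ?opprB// subr_lt0 (lt_le_trans js).
- by apply: (dich_unstable hN hdich); exact: lt_le_trans le1.
rewrite /Up /Tp.
have -> : j + 1 + k%:Z - 1 = j + k%:Z by lia.
have -> : j + k.+1%:Z = j + 1 + k%:Z by lia.
have E : expR (- (al - be) * (t (j + 1 + k%:Z) - s)) =
    expR (- (al - be) * (t (j + 1) - s)) * expR (- (al - be) * (t (j + 1 + k%:Z) - t (j + 1))).
  by rewrite -expRD; congr expR; ring.
rewrite E le_eqVlt; apply/orP; left; apply/eqP; ring.
Qed.

Hypothesis beal : be < al.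

(** The dichotomy controls the stable parts only at times after the impulses. Convergence is
    therefore proved at time t j and carried back to time 0 by Z(0, t j). *)
Lemma stable_series j :
  exists a : 'cV[R]_n, (fun m => \sum_(k < m) P *m e (j - k%:Z)) @ \oo --> a.
Proof.
have [T0 U0 UT TU UT'] := backward_grid j.
have al0 : 0 < al - be by rewrite subr_gt0.
have [|l [xl _]] := @decay_series R n N hN (Tm j) (Um j) theta (al - be) T0 U0 al0 UT TU UT'
    (fun k => Z (t j) 0 *m (P *m e (j - k%:Z))) _ (mulr_ge0 (cst_ge0 (t j)) (expR_ge0 (- (al - be) * (t j - t j)))).
  by move=> k; exact: stable_term.
exists (Z 0 (t j) *m l); have := cvg_mulmxl hN (B := Z 0 (t j)) xl.
suff -> : (fun k => Z 0 (t j) *m \sum_(i < k) Z (t j) 0 *m (P *m e (j - i%:Z))) =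
  (fun m => \sum_(k < m) P *m e (j - k%:Z)) by [].
apply/funext => m; rewrite mulmx_sumr; apply: eq_bigr => i _.
by rewrite (transition_cocycle hN hg hA hA0 hZ) (transition_id hZ).
Qed.

Lemma unstable_series j :
  exists b : 'cV[R]_n, (fun m => \sum_(k < m) (1%:M - P) *m e (j + 1 + k%:Z)) @ \oo --> b.
Proof.
have [T0 U0 UT TU UT'] := forward_grid j.
have al0 : 0 < al - be by rewrite subr_gt0.
have [|l [xl _]] := @decay_series R n N hN (Tp j) (Up j) theta (al - be) T0 U0 al0 UT TU UT'
    (fun k => Z (t j) 0 *m ((1%:M - P) *m e (j + 1 + k%:Z))) _
    (mulr_ge0 (cst_ge0 (t j)) (expR_ge0 (- (al - be) * (t (j + 1) - t j)))).
  by move=> k; apply: unstable_term; exact: (pca_lt hg).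
exists (Z 0 (t j) *m l); have := cvg_mulmxl hN (B := Z 0 (t j)) xl.
suff -> : (fun k => Z 0 (t j) *m \sum_(i < k) Z (t j) 0 *m ((1%:M - P) *m e (j + 1 + i%:Z))) =
  (fun m => \sum_(k < m) (1%:M - P) *m e (j + 1 + k%:Z)) by [].
apply/funext => m; rewrite mulmx_sumr; apply: eq_bigr => i _.
by rewrite (transition_cocycle hN hg hA hA0 hZ) (transition_id hZ).
Qed.

Lemma series_bound j s (a b w : 'cV[R]_n) : t j <= s -> s < t (j + 1) ->
  (fun m => \sum_(k < m) P *m e (j - k%:Z)) @ \oo --> a ->
  (fun m => \sum_(k < m) (1%:M - P) *m e (j + 1 + k%:Z)) @ \oo --> b ->
  N w <= rho_ * `|s - zeta j| * (D * expR (be * `|s - tau|)) ->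
  N (Z s 0 *m (a - b) + w) <=
    2 * expR ((al - be) * theta) / (al - be) * cst_ s.
Proof.
move=> js sj ha hb hw.
have al0 : 0 < al - be by rewrite subr_gt0.
have [T0 U0 UT TU UT'] := backward_grid j.
have := @decay_series_limit R n N hN (Tm j) (Um j) theta (al - be) T0 U0 al0 UT TU UT'
    (fun k => P *m e (j - k%:Z)) (Z s 0) _ a
    (mulr_ge0 (cst_ge0 s) (expR_ge0 (- (al - be) * (s - t j)))) _ ha.
move=> /(_ (fun k => stable_term k js)).
have [T0' U0' UT1 TU1 UT1'] := forward_grid j.
have := @decay_series_limit R n N hN (Tp j) (Up j) theta (al - be) T0' U0' al0 UT1 TU1 UT1'
    (fun k => (1%:M - P) *m e (j + 1 + k%:Z)) (Z s 0) _ b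
    (mulr_ge0 (cst_ge0 s) (expR_ge0 (- (al - be) * (t (j + 1) - s)))) _ hb.
move=> /(_ (fun k => unstable_term k sj)) Nb Na.
have zj := pca_zeta hg j; have gap := pca_gap hg j.
rewrite mulmxBr; apply: le_trans (ND hN _ _) _.
apply: le_trans (lerD (NB hN _ _) hw) _.
apply: le_trans (lerD (lerD Na Nb) (lexx _)) _.
(* K >= 1 lets the local term share the constant of the two series. *)
have hw' : rho_ * `|s - zeta j| * (D * expR (be * `|s - tau|)) <=
    cst_ s / (al - be) * ((al - be) * `|s - zeta j|).
  have -> : cst_ s / (al - be) * ((al - be) * `|s - zeta j|) = cst_ s * `|s - zeta j|.
    by field; rewrite gt_eqF.
  have -> : rho_ * `|s - zeta j| * (D * expR (be * `|s - tau|)) =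
      1 * (rho_ * D * expR (be * `|s - tau|) * `|s - zeta j|) by ring.
  have -> : cst_ s * `|s - zeta j| = K * (rho_ * D * expR (be * `|s - tau|) * `|s - zeta j|).
    by rewrite /cst_; ring.
  by rewrite ler_wpM2r ?(dich_K hdich)// !mulr_ge0 ?expR_ge0// ltW// rho_gt0.
apply: le_trans (lerD (lexx _) hw') _.
have -> : cst_ s * expR (- (al - be) * (s - t j)) / (al - be) *
      (expR ((al - be) * theta / 2) - (al - be) * Um j 0) +
    cst_ s * expR (- (al - be) * (t (j + 1) - s)) / (al - be) *
      (expR ((al - be) * theta / 2) - (al - be) * Up j 0) +
    cst_ s / (al - be) * ((al - be) * `|s - zeta j|) =
  cst_ s / (al - be) * (expR (- ((al - be) * (s - t j))) *
      (expR ((al - be) * theta / 2) + (al - be) * (zeta j - t j)) +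
    expR (- ((al - be) * (t (j + 1) - s))) *
      (expR ((al - be) * theta / 2) + (al - be) * (t (j + 1) - zeta j)) +
    (al - be) * `|s - zeta j|).
  have -> : Um j 0 = t j - zeta j by rewrite /Um subr0.
  have -> : Up j 0 = zeta j - t (j + 1) by rewrite /Up addr0.
  by rewrite -!mulNr; ring.
have -> : 2 * expR ((al - be) * theta) / (al - be) * cst_ s =
  cst_ s / (al - be) * (2 * expR ((al - be) * theta)) by ring.
apply: ler_wpM2l; first by rewrite divr_ge0 ?cst_ge0// ltW.
have al1 := ltW al0.
have fact : (al - be) * (s - t j) + (al - be) * (t (j + 1) - s) = (al - be) * (t (j + 1) - t j).
  by ring.
(* In units of 1 / (al - be): p and q are the distances of s from the ends of its cell, y1 and y2
   those of [zeta j], and y3 is the distance from s to [zeta j]. *)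
apply: green_scalar.
- by rewrite mulr_ge0// subr_ge0.
- by rewrite mulr_ge0// subr_ge0 ltW.
- by rewrite fact ler_pM2l.
- by rewrite mulr_ge0//; lra.
- by rewrite mulr_ge0//; lra.
- by rewrite fact; ring.
- by rewrite fact ler_pM2l// ler_norml; lra.
Qed.

End Impulses.
End GreenEstimate.

Section GreenOperator.
Variables (R : realType) (n : nat) (N : 'cV[R]_n -> R) (hN : is_norm N).
Variables (t zeta : int -> R) (theta : R) (gamma : R -> R).
Hypothesis hg : is_pca t zeta theta gamma.
Variables (A A0 : R -> 'M[R]_n) (M : R) (Z : R -> R -> 'M[R]_n) (P : 'M[R]_n) (K al : R).
Hypotheses (hA : continuous A) (hA0 : continuous A0) (M0 : 0 < M).
Hypothesis hAM : forall s, opnorm N (A s) <= M.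
Hypothesis hZ : is_transition t gamma A A0 Z.
Hypothesis hdich : exp_dichotomy N Z P K al.

(** The forcing is a family indexed by cells, so that each member can be continuous although the
    actual forcing jumps at the grid points. *)
Definition forced_solution (g : int -> R -> 'cV[R]_n) (z : R -> 'cV[R]_n) : Prop :=
  continuous z /\ forall i s, t i < s < t (i + 1) ->
    is_derive s (1 : R) z (lin_rhs A A0 s (z s) (z (zeta i)) + g i s).

Definition kappa (be : R) : R := 2 * K * rho_star N t zeta theta al A / (al - be).

Definition weighted_bound (z : R -> 'cV[R]_n) (D be tau : R) : Prop :=
  forall s, N (z s) <= D * expR (be * `|s - tau|).

(* On the cell [t j, t (j + 1)] the solution is Z(s, 0)(a_j - b_j) + w_j(s), where
   w_j' = A w_j + g_j and w_j(zeta_j) = 0, so that w_j does not feel A0. The jumps of the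
   w_j at the grid points are the impulses eta; a_j sums their stable parts up to j and
   b_j their unstable parts after j. *)
Lemma green_exists (g : int -> R -> 'cV[R]_n) (G0 : R) :
  (forall i, continuous (g i)) -> (forall i s, N (g i s) <= G0) ->
  exists z, forced_solution g z /\ forall be tau G, 0 <= be < al -> 0 <= G ->
    (forall i s, t i <= s <= t (i + 1) -> N (g i s) <= G * expR (be * `|s - tau|)) ->
    weighted_bound z (kappa be * G) be tau.
Proof.
move=> cg bg.
have [As hAs] := primitive (opnorm_continuous hN hA).
have G00 : 0 <= G0 by apply: le_trans (bg 0 0); exact: N_ge0.
have al0 := dich_alpha hdich.
have /choice[w hw] i := forced_exists hN hA M0 hAM (zeta i) (cg i) (bg i).
have wb be tau G : 0 <= be -> 0 <= G ->
    (forall i s, t i <= s <= t (i + 1) -> N (g i s) <= G * expR (be * `|s - tau|)) ->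
    forall i s, t i <= s <= t (i + 1) -> N (w i s) <=
      rho N t zeta A * `|s - zeta i| * (G * expR (be * theta) * expR (be * `|s - tau|)).
  move=> be0 G_ge0 gb i s si; have [w0 dw] := hw i.
  apply: (forced_bound hN hg hA M0 hAM hAs w0 dw _ si) => r ri.
  apply: le_trans (gb i r ri) _; rewrite -mulrA -expRD ler_wpM2l// ler_expR -mulrDr.
  rewrite ler_wpM2l//; have := ler_distD s r tau; have := cell_dist hg si ri; lra.
pose eta i := w (i - 1) (t i) - w i (t i).
have etab be tau G : 0 <= be -> 0 <= G ->
    (forall i s, t i <= s <= t (i + 1) -> N (g i s) <= G * expR (be * `|s - tau|)) ->
    forall i, N (eta i) <= rho N t zeta A * (zeta i - zeta (i - 1)) *
      (G * expR (be * theta) * expR (be * `|t i - tau|)).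
  move=> be0 G_ge0 gb i; have W := wb be tau G be0 G_ge0 gb.
  have zi := pca_zeta hg i; have zi1 := pca_zeta hg (i - 1); have lt1 := pca_lt hg i.
  have lt2 := pca_lt hg (i - 1); rewrite subrK in zi1 lt2.
  have W1 := W (i - 1) (t i) ltac:(rewrite subrK; lra); have W2 := W i (t i) ltac:(lra).
  apply: le_trans (NB hN _ _) _; apply: le_trans (lerD W1 W2) _.
  rewrite (@ger0_norm _ (t i - zeta (i - 1))); last by rewrite subr_ge0; lra.
  rewrite (@ler0_norm _ (t i - zeta i)); last by rewrite subr_le0; lra.
  rewrite le_eqVlt; apply/orP; left; apply/eqP; ring.
(* The series are summed with weight exponent 0, so [a], [b] and [z] do not depend on be or tau.
   Every weighted bound is later derived for this same [z]. *)
have gb0 i s : t i <= s <= t (i + 1) -> N (g i s) <= G0 * expR (0 * `|s - 0|).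
  by rewrite mul0r expR0 mulr1 => _; exact: bg.
have D0 : 0 <= G0 * expR (0 * theta) by rewrite mulr_ge0// expR_ge0.
have eta0 := etab 0 0 G0 (lexx _) G00 gb0.
have /choice[a ha] j := stable_series hN hg hA hA0 M0 hAM hZ hdich hAs D0 (lexx _) eta0 al0 j.
have /choice[b hb] j := unstable_series hN hg hA hA0 M0 hAM hZ hdich hAs D0 (lexx _) eta0 al0 j.
pose e i := Z 0 (t i) *m eta i.
have aS j : a (j + 1) = P *m e (j + 1) + a j.
  apply: (cV_cvg_unique (x := fun m => \sum_(k < m.+1) P *m e (j + 1 - k%:Z))).
    by have := ha (j + 1); rewrite -cvg_shiftS.
  have -> : (fun m => \sum_(k < m.+1) P *m e (j + 1 - k%:Z)) =
      (fun m => P *m e (j + 1) + \sum_(k < m) P *m e (j - k%:Z)).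
    apply/funext => m; rewrite big_ord_recl /= subr0; congr (_ + _).
    by apply: eq_bigr => k _; congr (_ *m e _); rewrite /bump /=; lia.
  by apply: cvgD; [exact: cvg_cst|exact: ha].
have bS j : b j = (1%:M - P) *m e (j + 1) + b (j + 1).
  apply: (cV_cvg_unique (x := fun m => \sum_(k < m.+1) (1%:M - P) *m e (j + 1 + k%:Z))).
    by have := hb j; rewrite -cvg_shiftS.
  have -> : (fun m => \sum_(k < m.+1) (1%:M - P) *m e (j + 1 + k%:Z)) =
      (fun m => (1%:M - P) *m e (j + 1) + \sum_(k < m) (1%:M - P) *m e (j + 1 + 1 + k%:Z)).
    apply/funext => m; rewrite big_ord_recl /= addr0; congr (_ + _).
    by apply: eq_bigr => k _; congr (_ *m e _); rewrite /bump /=; lia.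
  by apply: cvgD; [exact: cvg_cst|exact: hb].
pose us j s := Z s 0 *m (a j - b j) + w j s.
have cZ (x : 'cV[R]_n) : continuous (fun s => Z s 0 *m x) by have [] := transition_solution hN hg hA hA0 hZ 0 x.
have cw i : continuous (w i) by exact: (is_derive_continuous (hw i).2).
have cus j : continuous (us j).
  by move=> s; apply: cvgD; [exact: cZ|exact: cw].
have match_us j : us j (t (j + 1)) = us (j + 1) (t (j + 1)).
  (* As P and I - P add up to I, crossing t (j + 1) adds e (j + 1), which Z(t (j + 1), 0) carries to
     the jump [eta] that compensates the change of [w]. *)
  rewrite /us; have -> : a (j + 1) - b (j + 1) = (a j - b j) + e (j + 1).
    rewrite aS (bS j) mulmxBl mul1mx.
    by move: (P *m e (j + 1)) (e (j + 1)) (a j) (b (j + 1)) => p q x y; mx_ring.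
  rewrite [in RHS]mulmxDr -[in RHS]addrA; congr (_ + _).
  rewrite (transition_cocycle hN hg hA hA0 hZ) (transition_id hZ) /eta addrK.
  by rewrite subrK.
have [z [cz zE]] := glue_cells hN hg cus match_us.
exists z; split.
  split=> // i s si; have zi := pca_zeta hg i.
  rewrite (zE i (zeta i) zi) (zE i s); last by lra.
  apply: (is_derive_local si (v := us i)); first by move=> r ri; apply: zE; lra.
  have [_ dZ] := transition_solution hN hg hA hA0 hZ 0 (a i - b i).
  have [w0 dw] := hw i.
  have -> : lin_rhs A A0 s (us i s) (us i (zeta i)) + g i s =
      lin_rhs A A0 s (Z s 0 *m (a i - b i)) (Z (zeta i) 0 *m (a i - b i)) +
      (A s *m w i s + g i s).
    rewrite /us w0 addr0 /lin_rhs mulmxDr.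
    by move: (A s *m w i s) => p; rewrite !addrA; congr (_ + _); rewrite addrAC.
  exact: is_derive_funD (dZ i s si) (dw s).
move=> be tau G /andP[be0 beal] G_ge0 gb s.
have [j /andP[js sj]] := grid_cell hg s.
have sj' : t j <= s <= t (j + 1) by rewrite js ltW.
rewrite (zE j s sj').
have D_ge0 : 0 <= G * expR (be * theta) by rewrite mulr_ge0 ?expR_ge0.
have := series_bound hN hg hA M0 hAM hdich hAs D_ge0 be0 (etab be tau G be0 G_ge0 gb) beal
  js sj (ha j) (hb j) (wb be tau G be0 G_ge0 gb j s sj').
move=> /le_trans; apply.
rewrite /kappa /rho_star.
(* The first factor comes from [green_scalar], the second from moving the weight within a cell in
   [wb]. Together they give a [rho_star] that does not depend on be. *)
have -> : expR (al * theta) = expR ((al - be) * theta) * expR (be * theta).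
  by rewrite -expRD; congr expR; ring.
rewrite le_eqVlt; apply/orP; left; apply/eqP; ring.
Qed.

Lemma forced_solution_uniq (g : int -> R -> 'cV[R]_n) (z z' : R -> 'cV[R]_n) (B : R) :
  forced_solution g z -> forced_solution g z' -> (forall s, N (z s - z' s) <= B) -> z = z'.
Proof.
move=> [cz dz] [cz' dz'] hB; apply/funext => s; apply/eqP; rewrite -subr_eq0; apply/eqP.
apply: (bounded_solution0 hN hg hA hA0 hZ hdich (y := fun s => z s - z' s) _ hB).
split; first by move=> r; apply: cvgB; [exact: cz|exact: cz'].
move=> i r ri; have -> : lin_rhs A A0 r (z r - z' r) (z (zeta i) - z' (zeta i)) =
    lin_rhs A A0 r (z r) (z (zeta i)) + g i r - (lin_rhs A A0 r (z' r) (z' (zeta i)) + g i r).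
  rewrite /lin_rhs !mulmxBr.
  by move: (A r *m z r) (A r *m z' r) (A0 r *m z _) (A0 r *m z' _) (g i r) => *; mx_ring.
by apply: is_derive_funB; [exact: dz|exact: dz'].
Qed.

(** Mere boundedness of [z] identifies it with the solution of [green_exists], from which it
    inherits every weighted bound. *)
Lemma forced_solution_bound (g : int -> R -> 'cV[R]_n) (z : R -> 'cV[R]_n) (G0 B be tau G : R) :
  (forall i, continuous (g i)) -> (forall i s, N (g i s) <= G0) ->
  forced_solution g z -> (forall s, N (z s) <= B) -> 0 <= be < al -> 0 <= G ->
  (forall i s, t i <= s <= t (i + 1) -> N (g i s) <= G * expR (be * `|s - tau|)) ->
  weighted_bound z (kappa be * G) be tau.
Proof.
move=> cg bg sz bz beal G_ge0 gb.
have [z' [sz' hz']] := green_exists cg bg.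
have G00 : 0 <= G0 by apply: le_trans (bg 0 0); exact: N_ge0.
have al0 := dich_alpha hdich.
suff -> : z = z' by exact: hz'.
have := hz' 0 0 G0; rewrite lexx al0 => /(_ isT G00 _) H.
apply: (@forced_solution_uniq g z z' (B + kappa 0 * G0)) => // s.
apply: le_trans (NB hN _ _) _; apply: lerD => //.
have := H _ s; rewrite mul0r expR0 mulr1; apply=> i r _.
by rewrite mul0r expR0 mulr1.
Qed.

End GreenOperator.

(** * Hoelder conjugacy *)

Section Powers.
Variable R : realType.

Lemma le_powR_small (x q : R) : 0 <= x <= 1 -> 0 < q < 1 -> x <= x `^ q.
Proof.
move=> /andP[x0 x1] /andP[q0 q1]; move: x0; rewrite le_eqVlt => /predU1P[<-|x0].
  by rewrite powR0// gt_eqF.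
by rewrite -{1}(powRr1 (ltW x0)); apply: ger_powR; rewrite ?x0 ?x1// ltW.
Qed.

(** For E <= 1 the bound L E is used, since then E <= E^q; for E > 1 the bound B, since then E^q >=
    1. *)
Lemma interpolate_powR (x B L E q : R) : 0 <= B -> 0 <= L -> 0 <= E -> 0 < q < 1 ->
  x <= B -> x <= L * E -> x <= (B + L) * E `^ q.
Proof.
move=> B0 L0 E0 q01 xB xLE; have Eq0 := powR_ge0 E q.
have [E1|E1] := leP E 1.
  apply: le_trans xLE _; apply: (@le_trans _ _ (L * E `^ q)).
    by rewrite ler_wpM2l// le_powR_small// E0.
  by rewrite ler_wpM2r// lerDr.
have Eq1 : 1 <= E `^ q.
  by rewrite -[leLHS](powRr0 E) ler_powR ?(ltW E1)//; case/andP: q01 => /ltW.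
apply: le_trans xB _; apply: (@le_trans _ _ (B * E `^ q)); first by rewrite ler_peMr.
by rewrite ler_wpM2r// lerDl.
Qed.

Lemma powR_weight (d p q x : R) : 0 <= d ->
  (d * expR (p * x)) `^ q = d `^ q * expR (p * q * x).
Proof. by move=> d0; rewrite powRM ?expR_ge0// -expRM; congr (_ * expR _); ring. Qed.

(** The a priori bound [B] makes the supremum of phi finite; D is then taken to be this supremum and
    m D is absorbed. [B] itself does not enter the conclusion. *)
Lemma contraction_bound (T : Type) (phi : T -> R) (x0 : T) (B c m : R) :
  (forall s, 0 <= phi s) -> (forall s, phi s <= B) -> m < 1 ->
  (forall D, 0 <= D -> (forall s, phi s <= D) -> forall s, phi s <= c + m * D) ->
  forall s, phi s <= c / (1 - m).
Proof.
move=> phi0 phiB m1 H s.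
have hs : has_sup (range phi).
  by split; [exists (phi x0), x0|exists B => _ [r _ <-]].
have le_sup r : phi r <= sup (range phi) by apply: sup_upper_bound => //; exists r.
have sup0 : 0 <= sup (range phi) by exact: le_trans (phi0 x0) (le_sup x0).
have : sup (range phi) <= c + m * sup (range phi).
  by apply: ge_sup; [exists (phi x0), x0|move=> _ [r _ <-]; exact: H].
move=> h; apply: le_trans (le_sup s) _.
by rewrite ler_pdivlMr ?subr_gt0//; lra.
Qed.

(** At be = 0 the last inequality is the strict q0 < al, and continuity preserves it for small be >
    0. The condition be < p gives a Hoelder exponent be / p below 1. *)
Lemma small_exponent (al q0 theta p : R) : 0 < al -> 0 < p -> 0 <= q0 -> q0 < al ->
  exists be : R, [/\ 0 < be, be < al, be < p & q0 * expR (be * theta) < al - be].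
Proof.
move=> al0 p0 q00 qal.
pose h (be : R) := al - be - q0 * expR (theta * be).
have ch : continuous h.
  have dh (s : R) : is_derive s (1 : R) h (- 1 - q0 * (theta * expR (theta * s))).
    apply: is_derive_funB; last by apply: is_derive_scalel; exact: is_derive_expM.
    rewrite -[- 1]add0r; exact: (is_derive_funB (f := cst al) (is_derive_cst _ _ _) (is_derive_id _ _)).
  exact: (is_derive_continuous dh).
have [d d0 hd] := continuous_pos_nbhs (ch 0) ltac:(rewrite /h mulr0 expR0; lra).
pose be := Num.min d (Num.min al p) / 2.
have be0 : 0 < be by rewrite divr_gt0// !lt_min d0 al0 p0.
have be2 : be * 2 <= Num.min d (Num.min al p) by rewrite divfK.
move: be2; rewrite !le_min => /and3P[h1 h2 h3].
exists be; split; [exact: be0|lra|lra|].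
have := hd be; rewrite subr0 gtr0_norm// => /(_ ltac:(lra)).
by rewrite /h mulrC [theta * be]mulrC; lra.
Qed.

Lemma holder_unif_continuous (n : nat) (N : 'cV[R]_n -> R) (hN : is_norm N)
    (h : 'cV[R]_n -> 'cV[R]_n) (C q : R) : 0 < C -> 0 < q ->
  (forall x y, N (x - y) < 1 -> N (h x - h y) <= C * N (x - y) `^ q) -> unif_continuous h.
Proof.
move=> C0 q0 hh; have [c c0 hc] := norm_le_N hN; have [C' C'0 hC'] := N_le_norm hN.
apply/unif_continuousP => e e0.
have ec : 0 < e / c / C / 2 by rewrite !divr_gt0.
(* Chosen so that c C d^q = e / 2. *)
pose d := (e / c / C / 2) `^ q^-1.
have d0 : 0 < d by exact: powR_gt0.
have dq : d `^ q = e / c / C / 2 by rewrite /d -powRrM mulVf ?gt_eqF// powRr1// ltW.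
exists (Num.min 1 d / C') => [|[x y] /= xy].
  by rewrite /= divr_gt0// lt_min ltr01 d0.
move: xy; rewrite -!ball_normE /ball_ /= ltr_pdivlMr// => xy.
have {}xy : N (x - y) < Num.min 1 d.
  by apply: le_lt_trans xy; rewrite mulrC; exact: hC'.
move: xy; rewrite lt_min => /andP[xy1 xyd].
apply: le_lt_trans (hc _) _; rewrite mulrC -ltr_pdivlMr//.
apply: le_lt_trans (hh x y xy1) _; rewrite mulrC -ltr_pdivlMr//.
apply: (@le_lt_trans _ _ (d `^ q)).
  by apply: ge0_ler_powR; rewrite ?nnegrE ?(N_ge0 hN)// ltW.
by rewrite dq ltr_pdivrMr// ltr_pMr ?divr_gt0// ltr1n.
Qed.

Lemma holder_continuous (n : nat) (N : 'cV[R]_n -> R) (hN : is_norm N)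
    (h : 'cV[R]_n -> 'cV[R]_n) (C q : R) : 0 < C -> 0 < q ->
  (forall x y, N (x - y) < 1 -> N (h x - h y) <= C * N (x - y) `^ q) -> continuous h.
Proof.
move=> C0 q0 hh x; have /unif_continuousP u := holder_unif_continuous hN C0 q0 hh.
apply/(@cvgrPdist_lt _ _ _ _ (nbhs_filter x)) => e e0; have [d /= d0 hd] := u e e0.
apply/nbhs_ballP; exists d => // y xy; have := hd (x, y) xy.
by rewrite /= -ball_normE.
Qed.

End Powers.

Section Conjugacy.
Variables (R : realType) (n : nat) (N : 'cV[R]_n -> R) (hN : is_norm N).
Variables (t zeta : int -> R) (theta : R) (gamma : R -> R).
Hypothesis hg : is_pca t zeta theta gamma.
Variables (A A0 : R -> 'M[R]_n) (f : R -> 'cV[R]_n -> 'cV[R]_n -> 'cV[R]_n).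
Variables (M M0 mu l1 l2 : R) (Z : R -> R -> 'M[R]_n) (P : 'M[R]_n) (K al : R).
Hypotheses (hA : continuous A) (hA0 : continuous A0).
Hypothesis hf : continuous (fun p : R * 'cV[R]_n * 'cV[R]_n => f p.1.1 p.1.2 p.2).
Hypotheses (hM : 0 < M) (hM0 : 0 < M0) (hmu : 0 < mu) (hl1 : 0 < l1) (hl2 : 0 < l2).
Hypothesis hAM : forall s, opnorm N (A s) <= M.
Hypothesis hA0M : forall s, opnorm N (A0 s) <= M0.
Hypothesis hfmu : forall s x y, N (f s x y) <= mu.
Hypothesis hflip : forall s x x' y y',
  N (f s x y - f s x' y') <= l1 * N (x - x') + l2 * N (y - y').
Hypothesis htheta : 0 < theta.
Hypothesis hZ : is_transition t gamma A A0 Z.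
Hypothesis hdich : exp_dichotomy N Z P K al.
Hypothesis hcontr : 2 * (l1 + l2) * K * rho_star N t zeta theta al A < al.
Hypothesis hv1 : (M0 + l2) * ((expR ((M + l1) * theta) - 1) / (M + l1)) < 1.

Local Notation lin := (lin_rhs A A0).
Local Notation nonlin := (nonlin_rhs A A0 f).
Local Notation SL := (cell_solution t zeta lin).
Local Notation SN := (cell_solution t zeta nonlin).
Local Notation kap := (kappa N t zeta theta A K al).
Local Notation forced := (forced_solution t zeta A A0).

Lemma perturbation_continuous (x : R -> 'cV[R]_n) z : continuous x ->
  continuous (fun s => f s (x s) z).
Proof.
move=> cx s; apply: (@continuous_comp _ _ _ (fun s => (s, x s, z))
  (fun p : R * 'cV[R]_n * 'cV[R]_n => f p.1.1 p.1.2 p.2)); last exact: hf.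
have h1 : (r, x r) @[r --> s] --> (s, x s).
  by apply: (@cvg_pair _ _ _ (nbhs s) (nbhs s) (nbhs (x s))); [exact: cvg_id|exact: cx].
by apply: (@cvg_pair _ _ _ (nbhs s) (nbhs (s, x s)) (nbhs z)); [exact: h1|exact: cvg_cst].
Qed.

Lemma nonlin_rhs_continuous (x : R -> 'cV[R]_n) z : continuous x ->
  continuous (fun s => nonlin s (x s) z).
Proof.
move=> cx s; apply: cvgD; first exact: (lin_rhs_continuous hN hA hA0 cx).
exact: perturbation_continuous.
Qed.

(** Weakened to the constants of the nonlinear system, so that a single growth rate covers both. *)
Lemma lin_rhs_lipschitz s x x' y y' :
  N (lin s x y - lin s x' y') <= (M + l1) * N (x - x') + (M0 + l2) * N (y - y').
Proof.
have -> : lin s x y - lin s x' y' = A s *m (x - x') + A0 s *m (y - y').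
  by rewrite /lin_rhs !mulmxBr addrACA opprD.
apply: le_trans (ND hN _ _) _; apply: lerD; apply: le_trans (opnorm_le hN _ _) _;
  apply: ler_wpM2r; rewrite ?(N_ge0 hN)//.
- by apply: le_trans (hAM s) _; rewrite lerDl ltW.
- by apply: le_trans (hA0M s) _; rewrite lerDl ltW.
Qed.

Lemma nonlin_rhs_lipschitz s x x' y y' :
  N (nonlin s x y - nonlin s x' y') <= (M + l1) * N (x - x') + (M0 + l2) * N (y - y').
Proof.
have -> : nonlin s x y - nonlin s x' y' =
    A s *m (x - x') + A0 s *m (y - y') + (f s x y - f s x' y').
  rewrite /nonlin_rhs !mulmxBr.
  by move: (A s *m x) (A s *m x') (A0 s *m y) (A0 s *m y') (f s x y) (f s x' y') => *; mx_ring.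
have h1 := opnorm_le hN (A s) (x - x'); have h2 := opnorm_le hN (A0 s) (y - y').
have h3 := ler_wpM2r (N_ge0 hN (x - x')) (hAM s).
have h4 := ler_wpM2r (N_ge0 hN (y - y')) (hA0M s).
have h5 := hflip s x x' y y'.
apply: le_trans (ND hN _ _) _; apply: le_trans (lerD (ND hN _ _) (lexx _)) _.
rewrite !mulrDl; lra.
Qed.

Lemma forced_solutionB g g' z z' : forced g z -> forced g' z' ->
  forced (fun i s => g i s - g' i s) (fun s => z s - z' s).
Proof.
move=> [cz dz] [cz' dz']; split; first by move=> r; apply: cvgB; [exact: cz|exact: cz'].
move=> i r ri; have -> : lin r (z r - z' r) (z (zeta i) - z' (zeta i)) + (g i r - g' i r) =
    lin r (z r) (z (zeta i)) + g i r - (lin r (z' r) (z' (zeta i)) + g' i r).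
  rewrite /lin_rhs !mulmxBr.
  by move: (A r *m z r) (A r *m z' r) (A0 r *m z _) (A0 r *m z' _) (g i r) (g' i r) => *; mx_ring.
exact: is_derive_funB (dz i r ri) (dz' i r ri).
Qed.

Definition partners (X Y : R -> 'cV[R]_n) : Prop :=
  [/\ SN X, SL Y & forall s, N (X s - Y s) <= kap 0 * mu].

Lemma partners_forced X Y : SN X -> SL Y ->
  forced (fun i s => f s (X s) (X (zeta i))) (fun s => X s - Y s).
Proof.
move=> [cX dX] [cY dY]; split; first by move=> r; apply: cvgB; [exact: cX|exact: cY].
move=> i r ri; have -> : lin r (X r - Y r) (X (zeta i) - Y (zeta i)) + f r (X r) (X (zeta i)) =
    nonlin r (X r) (X (zeta i)) - lin r (Y r) (Y (zeta i)).
  rewrite /lin_rhs /nonlin_rhs !mulmxBr.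
  by move: (A r *m X r) (A r *m Y r) (A0 r *m X _) (A0 r *m Y _) (f _ _ _) => *; mx_ring.
exact: is_derive_funB (dX i r ri) (dY i r ri).
Qed.

Lemma al_gt0 : 0 < al. Proof. exact: dich_alpha hdich. Qed.

Lemma zero_weight (x D : R) : D * expR (0 * x) = D.
Proof. by rewrite mul0r expR0 mulr1. Qed.

Lemma kappa_gt0 be : be < al -> 0 < kap be.
Proof.
move=> beal; have [As hAs] := primitive (opnorm_continuous hN hA).
have K1 := dich_K hdich; have r1 := rho_ge1 hN hg hA hM hAM hAs.
rewrite /kappa divr_gt0 ?subr_gt0// /rho_star !mulr_gt0 ?expR_gt0//; lra.
Qed.

Lemma green_bounded (g : int -> R -> 'cV[R]_n) (G : R) :
  (forall i, continuous (g i)) -> (forall i s, N (g i s) <= G) ->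
  exists z, forced g z /\ forall s, N (z s) <= kap 0 * G.
Proof.
move=> cg gG; have [z [sz hz]] := green_exists hN hg hA hA0 hM hAM hZ hdich cg gG.
exists z; split=> // s.
have G0 : 0 <= G by apply: le_trans (gG 0 0); exact: N_ge0.
have b0 : 0 <= (0 : R) < al by rewrite lexx al_gt0.
have gw i r : t i <= r <= t (i + 1) -> N (g i r) <= G * expR (0 * `|r - 0|).
  by rewrite zero_weight.
by have := hz 0 0 G b0 G0 gw s; rewrite zero_weight.
Qed.

(** The forcing f along X is known, so subtracting one bounded forced solution suffices. *)
Lemma partner_linear X : SN X -> exists Y, partners X Y.
Proof.
move=> SX; have [cX dX] := SX.
have cg i : continuous (fun s => f s (X s) (X (zeta i))) by exact: perturbation_continuous.
have [z [sz hz]] := green_bounded cg (fun i s => hfmu s _ _).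
exists (fun s => X s - z s); split=> //.
  split; first by move=> r; apply: cvgB; [exact: cX|exact: sz.1].
  move=> i r ri; have -> : lin r (X r - z r) (X (zeta i) - z (zeta i)) =
      nonlin r (X r) (X (zeta i)) - (lin r (z r) (z (zeta i)) + f r (X r) (X (zeta i))).
    rewrite /lin_rhs /nonlin_rhs !mulmxBr.
    by move: (A r *m X r) (A r *m z r) (A0 r *m X _) (A0 r *m z _) (f _ _ _) => *; mx_ring.
  exact: is_derive_funB (dX i r ri) (sz.2 i r ri).
by move=> s; rewrite subKr.
Qed.

Lemma contraction_lt1 : kap 0 * (l1 + l2) < 1.
Proof. by rewrite /kappa subr0 mulrAC ltr_pdivrMr ?al_gt0// mul1r; move: hcontr; lra. Qed.

(** Here the forcing depends on the unknown X = Y + z, and z is a fixed point of the map that sends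
    z to the bounded solution forced by f along Y + z. With the constant weight 1 it contracts by
    kappa(0) (l1 + l2). *)
Lemma partner_nonlinear Y : SL Y -> exists X, partners X Y.
Proof.
move=> SY; have [cY dY] := SY.
have al0 := al_gt0; have k0 := kappa_gt0 al0.
pose g (z : R -> 'cV[R]_n) i s := f s (Y s + z s) (Y (zeta i) + z (zeta i)).
have cg z i : continuous z -> continuous (g z i).
  move=> cz; apply: perturbation_continuous => r.
  by apply: cvgD; [exact: cY|exact: cz].
have gmu z i s : N (g z i s) <= mu by exact: hfmu.
have /choice[Op hOp] (z : R -> 'cV[R]_n) : exists z' : R -> 'cV[R]_n,
    continuous z -> forced (g z) z' /\ forall s, N (z' s) <= kap 0 * mu.
  have [cz|ncz] := pselect (continuous z); last by exists z.
  by have [z' hz'] := green_bounded (fun i => cg z i cz) (gmu z); exists z'.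
have q01 : 0 < kap 0 * (l1 + l2) < 1 by rewrite contraction_lt1 mulr_gt0// addr_gt0.
have c0 : continuous (cst 0 : R -> 'cV[R]_n) by move=> s; exact: cst_continuous.
have [| | | | | |z cz hz] := @weighted_fixpoint R n N hN R (fun=> 1) (fun z => continuous z) Op
    (kap 0 * (l1 + l2)) (kap 0 * mu) (cst 0) q01 _ _ _ _ _ c0 _.
- by [].
- by rewrite mulr_ge0// ltW.
- by move=> z cz; exact: (hOp z cz).1.1.
- move=> u w C C0 cu cw uw s; rewrite mulr1.
  have [su bu] := hOp u cu; have [sw bw] := hOp w cw.
  have := @forced_solution_bound R n N hN t zeta theta gamma hg A A0 M Z P K al hA hA0 hM hAM hZ
    hdich _ _ (mu + mu) (kap 0 * mu + kap 0 * mu) 0 0 ((l1 + l2) * C)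
    _ _ (forced_solutionB su sw) _ _ _ _ s.
  rewrite zero_weight mulrA; apply.
  + by move=> i r; apply: cvgB; [exact: cg|exact: cg].
  + by move=> i r; apply: le_trans (NB hN _ _) _; rewrite lerD.
  + by move=> r; apply: le_trans (NB hN _ _) _; rewrite lerD.
  + by rewrite lexx al0.
  + by rewrite mulr_ge0// addr_ge0 ?ltW.
  + move=> i r _; rewrite zero_weight; apply: le_trans (hflip _ _ _ _ _) _.
    have E (a b c : 'cV[R]_n) : a + b - (a + c) = b - c by mx_ring.
    rewrite !E mulrDl; have := uw r; have := uw (zeta i); rewrite !mulr1 => h1 h2.
    by apply: lerD; rewrite ler_pM2l.
- move=> us u C C0 cus hu; apply: (weighted_limit_continuous hN (w := fun=> 1) _ _ C0 q01 cus hu) => //.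
  by move=> r; exact: cst_continuous.
- by move=> s; rewrite subr0 mulr1; exact: (hOp _ c0).2.
have [sz bz] := hOp z cz; have Oz : Op z = z by apply/funext.
rewrite Oz in sz bz.
exists (fun s => Y s + z s); split=> //.
  split; first by move=> r; apply: cvgD; [exact: cY|exact: cz].
  move=> i r ri; have -> : nonlin r (Y r + z r) (Y (zeta i) + z (zeta i)) =
      lin r (Y r) (Y (zeta i)) + (lin r (z r) (z (zeta i)) + g z i r).
    rewrite /lin_rhs /nonlin_rhs /g !mulmxDr.
    by move: (A r *m Y r) (A r *m z r) (A0 r *m Y _) (A0 r *m z _) (f _ _ _) => *; mx_ring.
  exact: is_derive_funD (dY i r ri) (sz.2 i r ri).
by move=> s; rewrite addrC addKr.
Qed.

Let v := (M0 + l2) * ((expR ((M + l1) * theta) - 1) / (M + l1)).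
Definition growth_rate : R := (M + l1) + (M0 + l2) * (expR ((M + l1) * theta) / (1 - v)).
(** The factor exp (growth_rate theta) is the price of replacing the weight at [zeta i] by the
    weight at s. *)
Let lip : R := l1 + l2 * expR (growth_rate * theta).

Lemma growth_rate_gt0 : 0 < growth_rate.
Proof.
apply: addr_gt0; first exact: addr_gt0.
apply: mulr_gt0; first exact: addr_gt0.
by apply: divr_gt0; rewrite ?expR_gt0// subr_gt0.
Qed.

Lemma lip_gt0 : 0 < lip.
Proof. by rewrite /lip addr_gt0// mulr_gt0// expR_gt0. Qed.

Lemma nonlinear_growth X X' r s : SN X -> SN X' ->
  N (X s - X' s) <= expR (growth_rate * `|s - r|) * N (X r - X' r).
Proof.
move=> SX SX'.
exact: (cell_solution_growth hN hg (addr_gt0 hM hl1) (addr_gt0 hM0 hl2) hv1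
  nonlin_rhs_lipschitz SX SX' r s).
Qed.

Lemma linear_growth Y Y' r s : SL Y -> SL Y' ->
  N (Y s - Y' s) <= expR (growth_rate * `|s - r|) * N (Y r - Y' r).
Proof.
move=> SY SY'.
exact: (cell_solution_growth hN hg (addr_gt0 hM hl1) (addr_gt0 hM0 hl2) hv1
  lin_rhs_lipschitz SY SY' r s).
Qed.

Lemma weight_zeta (p tau s : R) i : 0 <= p -> t i <= s <= t (i + 1) ->
  expR (p * `|zeta i - tau|) <= expR (p * theta) * expR (p * `|s - tau|).
Proof.
move=> p0 si; rewrite -expRD ler_expR -mulrDr ler_wpM2l//.
have := ler_distD s (zeta i) tau; have := cell_dist hg si (pca_zeta hg i); lra.
Qed.

Lemma lipschitz_weight (d : R -> 'cV[R]_n) (delta tau s : R) i : 0 <= delta ->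
  (forall r, N (d r) <= expR (growth_rate * `|r - tau|) * delta) ->
  t i <= s <= t (i + 1) ->
  l1 * N (d s) + l2 * N (d (zeta i)) <= lip * (delta * expR (growth_rate * `|s - tau|)).
Proof.
move=> delta0 hd si.
have wz := weight_zeta tau (ltW growth_rate_gt0) si.
have h1 := ler_wpM2l (ltW hl1) (hd s).
have h2 := ler_wpM2l (ltW hl2) (le_trans (hd (zeta i)) (ler_wpM2r delta0 wz)).
apply: le_trans (lerD h1 h2) _; rewrite /lip le_eqVlt; apply/orP; left; apply/eqP; ring.
Qed.

Section Holder.
Variables (be q tau : R) (X X' Y Y' : R -> 'cV[R]_n).
Hypotheses (be0 : 0 < be) (beal : be < al) (q01 : 0 < q < 1) (qE : growth_rate * q = be).
Hypotheses (XY : partners X Y) (XY' : partners X' Y').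

Let e s := (X s - Y s) - (X' s - Y' s).
Let g i s := f s (X s) (X (zeta i)) - f s (X' s) (X' (zeta i)).

Lemma deviation_bound (G : R) : 0 <= G ->
  (forall i s, t i <= s <= t (i + 1) -> N (g i s) <= G * expR (be * `|s - tau|)) ->
  forall s, N (e s) <= kap be * G * expR (be * `|s - tau|).
Proof.
move=> G0 gG; have [SX SY bXY] := XY; have [SX' SY' bXY'] := XY'.
apply: (@forced_solution_bound R n N hN t zeta theta gamma hg A A0 M Z P K al hA hA0 hM hAM hZ
    hdich g e (mu + mu) (kap 0 * mu + kap 0 * mu) be tau G) => //.
- have [cX _] := SX; have [cX' _] := SX'.
  by move=> i s; apply: cvgB; exact: perturbation_continuous.
- by move=> i s; apply: le_trans (NB hN _ _) _; rewrite lerD.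
- exact: forced_solutionB (partners_forced SX SY) (partners_forced SX' SY').
- by move=> s; apply: le_trans (NB hN _ _) _; rewrite lerD.
- by rewrite ltW.
Qed.

(** Only the part of g driven by the initial distance is interpolated. The remainder x, in
    [holder_backward] the feedback of e, stays linear so that it can be absorbed. *)
Lemma g_le_interpolated i s x (delta : R) : 0 <= delta -> 0 <= x ->
  N (g i s) <= lip * (delta * expR (growth_rate * `|s - tau|)) + x ->
  N (g i s) <= (2 * mu + lip) * (delta `^ q) * expR (be * `|s - tau|) + x.
Proof.
move=> delta0 x0 h; rewrite -lerBlDr -mulrA.
have -> : delta `^ q * expR (be * `|s - tau|) = (delta * expR (growth_rate * `|s - tau|)) `^ q.
  by rewrite powR_weight// qE.
apply: interpolate_powR => //.
- by rewrite mulr_ge0// ltW.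
- exact: ltW lip_gt0.
- by rewrite mulr_ge0// expR_ge0.
- have := NB hN (f s (X s) (X (zeta i))) (f s (X' s) (X' (zeta i))).
  have := hfmu s (X s) (X (zeta i)); have := hfmu s (X' s) (X' (zeta i)); rewrite -/(g i s); lra.
- by rewrite lerBlDr.
Qed.

Lemma const_ge0 (delta : R) : 0 <= (2 * mu + lip) * delta `^ q.
Proof. by rewrite mulr_ge0 ?powR_ge0// addr_ge0 ?(ltW lip_gt0)// mulr_ge0// ltW. Qed.

(** X - X' controls g directly through the growth of nonlinear solutions, so nothing has to be
    absorbed and any be below al is allowed. *)
Lemma holder_forward : N (X tau - X' tau) < 1 ->
  N (Y tau - Y' tau) <= (1 + kap be * (2 * mu + lip)) * N (X tau - X' tau) `^ q.
Proof.
have [SX SY _] := XY; have [SX' SY' _] := XY'.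
set delta := N _ => delta1; have delta0 : 0 <= delta by exact: N_ge0.
have H := @deviation_bound ((2 * mu + lip) * delta `^ q) (const_ge0 _) _ tau.
have -> : Y tau - Y' tau = (X tau - X' tau) - e tau by rewrite /e; mx_ring.
apply: le_trans (NB hN _ _) _; rewrite mulrDl mul1r lerD//.
  by rewrite le_powR_small// delta0 ltW.
rewrite -mulrA; apply: le_trans (H _) _; last first.
  by rewrite subrr normr0 mulr0 expR0 mulr1.
move=> i s si; rewrite -[leRHS]addr0; apply: g_le_interpolated => //; rewrite addr0.
apply: le_trans (hflip _ _ _ _ _) _.
apply: (lipschitz_weight (d := fun s => X s - X' s)) => // r.
exact: nonlinear_growth.
Qed.

(** Only Y - Y' is controlled by growth. As X - X' = (Y - Y') + e, the deviation e enters its own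
    forcing; after division by the weight it is bounded by 2 kappa(0) mu, and [contraction_bound]
    absorbs it. The factor exp (be theta) in m comes from the value of e at [zeta i]. *)
Lemma holder_backward : kap be * ((l1 + l2) * expR (be * theta)) < 1 ->
  N (Y tau - Y' tau) < 1 ->
  N (X tau - X' tau) <=
    (1 + kap be * (2 * mu + lip) / (1 - kap be * ((l1 + l2) * expR (be * theta)))) *
    N (Y tau - Y' tau) `^ q.
Proof.
have [SX SY bXY] := XY; have [SX' SY' bXY'] := XY'.
set m := kap be * _ => m1; set delta := N (Y _ - _) => delta1.
have delta0 : 0 <= delta by exact: N_ge0.
have k0 := kappa_gt0 beal.
pose phi s := N (e s) * expR (- (be * `|s - tau|)).
have phiE D s : (phi s <= D) = (N (e s) <= D * expR (be * `|s - tau|)).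
  by rewrite /phi expRN ler_pdivrMr ?expR_gt0.
have := @contraction_bound R R phi 0 (kap 0 * mu + kap 0 * mu)
  (kap be * ((2 * mu + lip) * delta `^ q)) m _ _ m1 _ tau.
move=> H; have {}H : phi tau <= kap be * ((2 * mu + lip) * delta `^ q) / (1 - m).
  apply: H.
  - by move=> s; rewrite mulr_ge0 ?expR_ge0// N_ge0.
  - move=> s; rewrite -[leRHS]mulr1; apply: ler_pM.
    + exact: N_ge0.
    + exact: expR_ge0.
    + by apply: le_trans (NB hN _ _) _; rewrite lerD.
    + by rewrite -[leRHS]expR0 ler_expR oppr_le0 mulr_ge0// ltW.
  move=> D D0 hD s; rewrite phiE.
  have {}hD r : N (e r) <= D * expR (be * `|r - tau|) by rewrite -phiE.
  have -> : kap be * ((2 * mu + lip) * delta `^ q) + m * D =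
      kap be * ((2 * mu + lip) * delta `^ q + (l1 + l2) * expR (be * theta) * D).
    by rewrite /m; ring.
  apply: deviation_bound.
    by rewrite addr_ge0 ?const_ge0// !mulr_ge0 ?expR_ge0// addr_ge0 ?ltW.
  move=> i r ri; rewrite mulrDl; apply: g_le_interpolated => //.
    by rewrite !mulr_ge0 ?expR_ge0// addr_ge0 ?ltW.
  apply: le_trans (hflip _ _ _ _ _) _.
  have XE x : X x - X' x = (Y x - Y' x) + e x by rewrite /e; mx_ring.
  have h1 : l1 * N (Y r - Y' r) + l2 * N (Y (zeta i) - Y' (zeta i)) <=
      lip * (delta * expR (growth_rate * `|r - tau|)).
    apply: (lipschitz_weight (d := fun s => Y s - Y' s)) => // x.
    exact: linear_growth.
  have h2 := ler_wpM2l (ltW hl1) (ND hN (Y r - Y' r) (e r)).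
  have h3 := ler_wpM2l (ltW hl2) (ND hN (Y (zeta i) - Y' (zeta i)) (e (zeta i))).
  have wz := weight_zeta tau (ltW be0) ri.
  have h4 := ler_wpM2l (ltW hl2) (le_trans (hD (zeta i)) (ler_wpM2l D0 wz)).
  have h5 : l1 * N (e r) <= l1 * (D * (expR (be * theta) * expR (be * `|r - tau|))).
    rewrite ler_wpM2l ?(ltW hl1)//; apply: le_trans (hD r) _; rewrite ler_wpM2l//.
    by rewrite ler_peMl ?expR_ge0// -[leLHS]expR0 ler_expR mulr_ge0// ltW.
  rewrite !XE.
  have -> : (l1 + l2) * expR (be * theta) * D * expR (be * `|r - tau|) =
    l1 * (D * (expR (be * theta) * expR (be * `|r - tau|))) +
    l2 * (D * (expR (be * theta) * expR (be * `|r - tau|))) by ring.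
  rewrite !mulrDr in h2 h3; lra.
have -> : X tau - X' tau = (Y tau - Y' tau) + e tau by rewrite /e; mx_ring.
apply: le_trans (ND hN _ _) _; rewrite mulrDl mul1r lerD//.
  by rewrite le_powR_small// delta0 ltW.
move: H; rewrite phiE subrr normr0 mulr0 expR0 mulr1 => /le_trans; apply.
by rewrite le_eqVlt; apply/orP; left; apply/eqP; field; rewrite subr_eq0 gt_eqF.
Qed.

End Holder.

Lemma conjugacy : holder_strong_top_equiv N (is_solution t gamma lin) (is_solution t gamma nonlin).
Proof.
have al0 := al_gt0; have p0 := growth_rate_gt0.
have [be [be0 beal bep hbe]] : exists be : R, [/\ 0 < be, be < al, be < growth_rate &
    2 * (l1 + l2) * K * rho_star N t zeta theta al A * expR (be * theta) < al - be].
  apply: small_exponent => //.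
  have := kappa_gt0 al0; rewrite /kappa subr0 pmulr_lgt0 ?invr_gt0// => h.
  have -> : 2 * (l1 + l2) * K * rho_star N t zeta theta al A =
    (l1 + l2) * (2 * K * rho_star N t zeta theta al A) by ring.
  by rewrite mulr_ge0 ?(ltW h)// addr_ge0 ?ltW.
have k0 := kappa_gt0 beal.
pose q := be / growth_rate.
have q01 : 0 < q < 1 by rewrite divr_gt0//= ltr_pdivrMr// mul1r.
have qE : growth_rate * q = be by rewrite mulrC divfK// gt_eqF.
have m1 : kap be * ((l1 + l2) * expR (be * theta)) < 1.
  rewrite /kappa mulrAC ltr_pdivrMr ?subr_gt0// mul1r; move: hbe.
  by congr (_ < _); ring.
pose C := 1 + kap be * (2 * mu + lip).
pose D := 1 + kap be * (2 * mu + lip) / (1 - kap be * ((l1 + l2) * expR (be * theta))).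
have cl0 : 0 < kap be * (2 * mu + lip).
  by rewrite mulr_gt0// addr_gt0 ?lip_gt0// mulr_gt0.
have C1 : 1 < C by rewrite ltrDl.
have D1 : 1 < D by rewrite ltrDl divr_gt0// subr_gt0.
have existsX tau xi : exists u, SN u /\ u tau = xi.
  apply: (cell_solution_exists hN hg (addr_gt0 hM hl1) (addr_gt0 hM0 hl2) htheta hv1
    nonlin_rhs_continuous nonlin_rhs_lipschitz (m := mu)) => s.
  by rewrite /nonlin_rhs !mulmx0 !add0r.
have existsY tau xi : exists u, SL u /\ u tau = xi.
  exists (fun s => Z s tau *m xi); split; last exact: (transition_id hZ tau xi).
  exact: (transition_solution hN hg hA hA0 hZ tau xi).
(* [HH] and [LL] are chosen independently from this one relation; its uniqueness on either side,
   [uniqH] and [uniqL], makes them mutually inverse. *)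
pose related (tau : R) (xi nu : 'cV[R]_n) := exists X Y, [/\ partners X Y, X tau = xi & Y tau = nu].
have /choice[HH hHH] (p : R * 'cV[R]_n) : exists nu, related p.1 p.2 nu.
  have [X [SX Xt]] := existsX p.1 p.2; have [Y XY] := partner_linear SX.
  by exists (Y p.1), X, Y.
have /choice[LL hLL] (p : R * 'cV[R]_n) : exists xi, related p.1 xi p.2.
  have [Y [SY Yt]] := existsY p.1 p.2; have [X XY] := partner_nonlinear SY.
  by exists (X p.1), X, Y.
pose H s u := HH (s, u); pose L s u := LL (s, u).
have rH s u : related s u (H s u) by exact: (hHH (s, u)).
have rL s u : related s (L s u) u by exact: (hLL (s, u)).
have holdH s xi nu xi' nu' : related s xi nu -> related s xi' nu' -> N (xi - xi') < 1 ->
    N (nu - nu') <= C * N (xi - xi') `^ q.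
  move=> [X [Y [XY <- <-]]] [X' [Y' [XY' <- <-]]].
  exact: (holder_forward be0 beal q01 qE XY XY').
have holdL s xi nu xi' nu' : related s xi nu -> related s xi' nu' -> N (nu - nu') < 1 ->
    N (xi - xi') <= D * N (nu - nu') `^ q.
  move=> [X [Y [XY <- <-]]] [X' [Y' [XY' <- <-]]].
  exact: (holder_backward be0 beal q01 qE XY XY' m1).
have N0_eq (x y : 'cV[R]_n) c : N (x - y) <= c * N (0 : 'cV[R]_n) `^ q -> x = y.
  have /andP[q0 _] := q01; rewrite (N0 hN) powR0 ?gt_eqF// mulr0 => h.
  by apply/eqP; rewrite -subr_eq0; apply/eqP/(norm_definite hN)/le_anti; rewrite h N_ge0.
have N01 : N (0 : 'cV[R]_n) < 1 by rewrite (N0 hN) ltr01.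
have uniqH s xi nu nu' : related s xi nu -> related s xi nu' -> nu = nu'.
  by move=> r r'; apply: (N0_eq _ _ C); have := holdH _ _ _ _ _ r r'; rewrite subrr; apply.
have uniqL s xi xi' nu : related s xi nu -> related s xi' nu -> xi = xi'.
  by move=> r r'; apply: (N0_eq _ _ D); have := holdL _ _ _ _ _ r r'; rewrite subrr; apply.
have HK s : cancel (H s) (L s) by move=> u; exact: uniqL (rL s (H s u)) (rH s u).
have LK s : cancel (L s) (H s) by move=> u; exact: uniqH (rH s (L s u)) (rL s u).
have hH s x y : N (x - y) < 1 -> N (H s x - H s y) <= C * N (x - y) `^ q.
  exact: holdH.
have hL s x y : N (x - y) < 1 -> N (L s x - L s y) <= D * N (x - y) `^ q.
  exact: holdL.
have C0 : 0 < C by exact: lt_trans C1.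
have D0 : 0 < D by exact: lt_trans D1.
have q0 : 0 < q by case/andP: q01.
have cH s : continuous (H s) by exact: (holder_continuous hN C0 q0 (hH s)).
have cL s : continuous (L s) by exact: (holder_continuous hN D0 q0 (hL s)).
have linP u := is_solutionP hN hg u (fun x z => @lin_rhs_continuous R n N hN A A0 hA hA0 x z).
have nonlinP u := is_solutionP hN hg u nonlin_rhs_continuous.
exists H, L; split; last first.
  by exists C, D, q, q; split=> // s; split=> x y; [exact: hH|exact: hL].
split; last 2 first.
- by move=> s; exact: (holder_unif_continuous hN C0 q0 (hH s)).
- by move=> s; exact: (holder_unif_continuous hN D0 q0 (hL s)).
split; first by move=> s; split.
- split.
  + by move=> s; split=> //; exists (L s).
  + exists (kap 0 * mu) => s u; have [X [Y [[_ _ bXY] Xs Ys]]] := rH s u.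
    by rewrite (NBC hN) -{1}Xs -Ys.
  (* A solution and its partner are related at every time, so uniqueness identifies H s (x s) with Y
     s for all s at once. *)
  + move=> x /nonlinP Sx; have [Y xY] := partner_linear Sx.
    have -> : (fun s => H s (x s)) = Y.
      by apply/funext => s; apply: uniqH (rH s (x s)) _; exists x, Y.
    by apply/linP; have [] := xY.
- split.
  + by move=> s; split=> //; exists (H s).
  + exists (kap 0 * mu) => s u; have [X [Y [[_ _ bXY] Xs Ys]]] := rL s u.
    by rewrite -Xs -Ys.
  + move=> y /linP Sy; have [X Xy] := partner_nonlinear Sy.
    have -> : (fun s => L s (y s)) = X.
      by apply/funext => s; apply: uniqL (rL s (y s)) _; exists X, y.
    by apply/nonlinP; have [] := Xy.
Qed.

End Conjugacy.

Theorem theorem3 (R : realType) (n : nat) (N : 'cV[R]_n -> R)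
  (A A0 : R -> 'M[R]_n) (f : R -> 'cV[R]_n -> 'cV[R]_n -> 'cV[R]_n)
  (M M0 mu l1 l2 : R)
  (t zeta : int -> R) (theta : R) (gamma : R -> R)
  (nup num : R)
  (Phi : R -> 'M[R]_n) (Z : R -> R -> 'M[R]_n)
  (P : 'M[R]_n) (K alpha : R) (v vt : R)
  (hN : is_norm N)
  (hA : continuous A) (hA0 : continuous A0)
  (hf : continuous (fun p : R * 'cV[R]_n * 'cV[R]_n => f p.1.1 p.1.2 p.2))
  (hM : 0 < M) (hM0 : 0 < M0) (hmu : 0 < mu) (hl1 : 0 < l1) (hl2 : 0 < l2)
  (hAM : forall s, opnorm N (A s) <= M)
  (hA0M : forall s, opnorm N (A0 s) <= M0)
  (hfmu : forall s x y, N (f s x y) <= mu)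
  (hflip : forall s x x' y y',
     N (f s x y - f s x' y') <= l1 * N (x - x') + l2 * N (y - y'))
  (htheta : 0 < theta) (hgamma : is_pca t zeta theta gamma)
  (hnup : 0 < nup) (hnum : 0 < num)
  (hrhop : sup (range (fun k : int =>
     rho_plus N t zeta A k * ln (rho_plus N t zeta A0 k))) <= nup)
  (hnup1 : nup < 1)
  (hrhom : sup (range (fun k : int =>
     rho_minus N t zeta A k * ln (rho_minus N t zeta A0 k))) <= num)
  (hnum1 : num < 1)
  (hPhi : is_fundamental A Phi)
  (hZ : is_transition t gamma A A0 Z)
  (hdich : exp_dichotomy N Z P K alpha)
  (hser1 : forall k, abs_cvg_below N (term_plus t zeta Phi Z P) k)
  (hser2 : forall k, abs_cvg_below N (term_minus t zeta Phi Z P) k)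
  (hser3 : forall k, abs_cvg_above N (term_plus t zeta Phi Z (1%:M - P)) k)
  (hser4 : forall k, abs_cvg_above N (term_minus t zeta Phi Z (1%:M - P)) k)
  (hcontr : 2 * (l1 + l2) * K * rho_star N t zeta theta alpha A < alpha)
  (hv : exp_quot (M + l1) theta * (M0 + l2) * theta = v) (hv1 : v < 1)
  (hvt : exp_quot M theta * M0 * theta = vt) (hvt1 : vt < 1)
  (halpha : alpha < M + Num.min
     (l1 + (M0 + l2) / (1 - v) * expR ((M + l1) * theta))
     (M0 / (1 - vt) * expR (M * theta))) :
  holder_strong_top_equiv N
    (is_solution t gamma (lin_rhs A A0))
    (is_solution t gamma (nonlin_rhs A A0 f)).
Proof.
have a0 : M + l1 != 0 by rewrite gt_eqF// addr_gt0.
have th0 : theta != 0 by rewrite gt_eqF.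
apply: (conjugacy hN hgamma hA hA0 hf hM hM0 hmu hl1 hl2 hAM hA0M hfmu hflip
  htheta hZ hdich hcontr).
(* The factor theta cancels the one in the denominator of [exp_quot], leaving the Gronwall factor of
   one cell. *)
suff <- : v = (M0 + l2) * ((expR ((M + l1) * theta) - 1) / (M + l1)) by [].
by rewrite -hv /exp_quot; field; rewrite th0 a0.
Qed.
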